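(* Let $\theta=1$. Then the limiting Crump--Mode--Jagers process is the rate-one Yule process and $M_\infty\sim\mathrm{Exp}(1)$. Hence, with $G_i:=-\log M_\infty^{(i)}$ for $i=1,2$, the random variables $G_1,G_2,G_3$ are independent standard Gumbel random variables and $$S_\infty\stackrel{d}{=}G_1+G_2-G_3 .$$
   Context: For $\theta>0$ let $\mu_\theta(ds)=\frac{s^{\theta-1}}{\Gamma(\theta)}\,ds$ on $(0,\infty)$. The limiting Crump--Mode--Jagers process starts from one individual born at time $0$; every individual, independently of all others, gives birth to children at the ages given by the points of a Poisson point process on $(0,\infty)$ with intensity measure $\mu_\theta$. Let $Z_\theta(t)$ be the number of individuals (including the root) born by time $t$. Then $e^{-t}Z_\theta(t)\to M_\infty$ almost surely and in $L^1$ as $t\to\infty$, which defines $M_\infty$ (a.s. strictly positive). $S_\infty$ is a random variable with $$S_\infty\stackrel{d}{=}-\log M_\infty^{(1)}-\log M_\infty^{(2)}-G_3-\log\theta,$$ where $M_\infty^{(1)},M_\infty^{(2)}$ are i.i.d. copies of $M_\infty$ and $G_3$ is a standard Gumbel variable (distribution function $\exp(-e^{-x})$) independent of $(M_\infty^{(1)},M_\infty^{(2)})$. (It is the distributional limit of the centered, rescaled first-passage time $\mathfrak a_\ell T_n-\log n$ on the $\ell$-spread-out cycle of size $n$ when $\ell/n\to\lambda\in(0,1/2)$ and edge weights are i.i.d. $\mathrm{Exp}(1)^{1/\theta}$, with $\mathfrak a_\ell=((2\ell-1)\Gamma(\theta+1))^{1/\theta}$.) *)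

(* Defs.v *)
From HB Require Import structures.
From mathcomp Require Import all_boot all_order all_algebra.
From mathcomp Require Import finmap.
From mathcomp Require Import all_classical all_reals all_analysis.
From mathcomp Require Import measurable_realfun.
Import Order.TTheory GRing.Theory Num.Theory.
Import numFieldNormedType.Exports.

Set Implicit Arguments.
Unset Strict Implicit.
Unset Printing Implicit Defensive.

Local Open Scope classical_set_scope.
Local Open Scope ring_scope.

Section independence.
Local Open Scope ereal_scope.
Context {d} {T : measurableType d} {R : realType} (P : probability T R).

Definition independent_classes (I : choiceType) (C : I -> set (set T)) :=
  forall (J : {fset I}) (A : I -> set T),
    (forall i, i \in J -> C i (A i)) ->
    P (\bigcap_(i in [set` J]) A i) = \prod_(i <- J) P (A i).

Definition sigma_rv d' (T' : measurableType d') (X : T -> T') : set (set T) :=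
  preimage_set_system setT X measurable.

Definition mutually_independent d' (T' : measurableType d') (I : choiceType)
    (X : I -> T -> T') :=
  independent_classes (fun i => sigma_rv (X i)).

Definition independent2 d1 d2 (T1 : measurableType d1) (T2 : measurableType d2)
    (X : T -> T1) (Y : T -> T2) :=
  forall A B, measurable A -> measurable B ->
    P (X @^-1` A `&` Y @^-1` B) = P (X @^-1` A) * P (Y @^-1` B).

End independence.

(* Measures are functions on all sets, with meaningless values outside the
   sigma-algebra, so equality of laws is only required on measurable sets. *)
Definition same_law d (T : measurableType d) (R : realType)
    (mu nu : set T -> \bar R) :=
  forall A, measurable A -> mu A = nu A.

Section neg_ln.
Context d (T : measurableType d) (R : realType).

Definition neg_ln (X : T -> R) (w : T) : R := - ln (X w).

Lemma measurable_neg_ln (X : {mfun T >-> R}) : measurable_fun setT (neg_ln X).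
Proof.
by apply: measurableT_comp => //; apply: measurableT_comp.
Qed.

HB.instance Definition _ (X : {mfun T >-> R}) :=
  isMeasurableFun.Build _ _ _ _ (neg_ln X) (measurable_neg_ln X).

End neg_ln.

Definition standard_gumbel d (T : measurableType d) (R : realType)
    (P : probability T R) (X : {RV P >-> R}) :=
  forall x : R, cdf X x = (expR (- expR (- x)))%:E.

Definition Gamma {R : realType} (theta : R) : R :=
  (\int[lebesgue_measure]_(x in `]0, +oo[) (x `^ (theta - 1) * expR (- x)))%R.

(* mu_theta, as a measure on the whole line carried by (0, +oo). *)
Definition intensity {R : realType} (theta : R) (A : set R) : \bar R :=
  (\int[lebesgue_measure]_(s in A `&` `]0%R, +oo[)
     (s `^ (theta - 1) / Gamma theta)%:E)%E.

Section point_processes.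
Context {d} {T : measurableType d} {R : realType} (P : probability T R).

(* A point process with infinitely many points is given by an enumeration X of
   its points; [points_in X A] is the number of its points in A. *)
Definition points_in (X : nat -> T -> R) (A : set R) (w : T) : \bar R :=
  counting [set k | A (X k w)].

(* The [nat] argument of [poisson_prob] is a dummy. Unlike [poisson_pmf],
   [poisson_prob] is right at rate 0, where it is the Dirac mass at 0. *)
Definition poisson_point_process (mu : set R -> \bar R)
    (X : nat -> {RV P >-> R}) :=
  (forall A, measurable A -> (mu A < +oo)%E -> forall n : nat,
     P [set w | points_in X A w = n%:R%:E] =
     poisson_prob (fine (mu A)) 0 [set n]) /\
  (forall A : nat -> set R, (forall i, measurable (A i)) -> trivIset setT A ->
     mutually_independent P (fun i => points_in X (A i))).

End point_processes.

Section cmj.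
Context {d} {T : measurableType d} {R : realType} (P : probability T R).

(* Individuals are Ulam-Harris labels: [::] is the root and k :: u is the k-th
   child (counted from 0) of u. The age of u at the birth of k :: u is xi u k;
   children are labelled by order of birth, so that xi u is the ordered
   enumeration of the reproduction point process of u. *)
Record cmj_process (theta : R) (xi : seq nat -> nat -> {RV P >-> R}) : Prop := {
  cmj_poisson : forall u, poisson_point_process (intensity theta) (xi u) ;
  cmj_ordered : forall u,
    {ae P, forall w, {homo (fun k => xi u k w) : j k / (j <= k)%N >-> j <= k}} ;
  cmj_independent : independent_classes P
    (fun u => <<s \bigcup_k sigma_rv (xi u k) >>) }.

Fixpoint birth_time (xi : seq nat -> nat -> T -> R) (u : seq nat) (w : T) : R :=
  if u is k :: v then birth_time xi v w + xi v k w else 0.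

Definition cmj_size (xi : seq nat -> nat -> T -> R) (t : R) (w : T) : \bar R :=
  counting [set u | birth_time xi u w <= t].

Definition cmj_limit (xi : seq nat -> nat -> T -> R) (M : {RV P >-> R}) :=
  {ae P, forall w,
    ((expR (- t))%:E * cmj_size xi t w)%E @[t --> +oo] --> (M w)%:E}.

(* Pure birth process started at 1 with birth rate [rate * n] in state n:
   E n is the holding time in state n.+1. *)
Definition yule_process (rate : R) (Z : R -> T -> \bar R) :=
  exists E : nat -> {RV P >-> R},
    [/\ forall n, same_law (distribution P (E n))
                    (exponential_prob (rate * n.+1%:R)),
        mutually_independent P E
      & {ae P, forall w, forall t, 0 <= t ->
          Z t w =
          (1 + counting [set n | (\sum_(k < n.+1) E k w <= t)%R])%E}].

End cmj.

(* S is distributed as S_infty, represented through copies M1, M2 of M and a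
   Gumbel variable G3, all on one probability space. *)
Definition is_S_infty (R : realType) (theta : R)
    d (T : measurableType d) (P : probability T R) (M : {RV P >-> R})
    d' (T' : measurableType d') (P' : probability T' R)
    (M1 M2 G3 : {RV P' >-> R})
    d'' (T'' : measurableType d'') (P'' : probability T'' R)
    (S : {RV P'' >-> R}) :=
  [/\ same_law (distribution P' M1) (distribution P M) /\
      same_law (distribution P' M2) (distribution P M),
      independent2 P' M1 M2,
      standard_gumbel G3,
      independent2 P' (fun w => (M1 w, M2 w)) G3
    & same_law (distribution P'' S)
        (distribution P' ((neg_ln M1 : {mfun T' >-> R}) + neg_ln M2 - G3
                          - cst (ln theta) : {mfun T' >-> R}))].

(* Main.v *)
(* The ages at which individuals give birth are read on a grid of mesh e.
   Prescribing the succession h of the first n births and the discretised gaps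
   d_0, ..., d_(n-1) between them prescribes, for each individual concerned, the
   number of its points in finitely many disjoint cells; by independence this
   pattern has probability close to e^n exp(- e (sum_k (k+1) d_k)), whatever h
   is.  Patterns are disjoint and there are n! successions h, so summing
   geometric series and letting e tend to 0 bounds P(E_k in I_k for k < n) from
   below by the product of the exponential laws of rates k+1, E_k being the time
   between consecutive births.  Both sides have total mass 1, hence equality:
   the E_k are independent exponential variables and, almost surely, the
   population grows by successive births, i.e. it is a Yule process.

   By induction on n, E_0 + ... + E_(n-1) has distribution function
   (1 - exp(-t))^n, so the population size at time t is geometric with parameter
   exp(-t).  Comparing the events {M > x} and {exp(-j) Z_j > x} for large j
   identifies the law of M as Exp(1), and - log of an Exp(1) variable is Gumbel. *)
Require Import Defs.
From HB Require Import structures.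
From mathcomp Require Import all_boot all_order all_algebra.
From mathcomp Require Import finmap.
From mathcomp Require Import all_classical all_reals all_analysis.
From mathcomp Require Import measurable_realfun ring lra zify.
Import Order.TTheory GRing.Theory Num.Theory.
Import numFieldNormedType.Exports.
Local Open Scope classical_set_scope.
Local Open Scope ring_scope.
Set Implicit Arguments.
Unset Strict Implicit.
Unset Printing Implicit Defensive.

(** * Histories of the first births *)

(** Nothing is conditioned on the past: since each individual is observed separately on its own
    clock, independence gives a plain product. The price is that ages are rounded, not birth times.
    The rounded birth time of the [i]-th individual may exceed the true one by up to [i] cells, so
    gaps must be longer than [n] cells and observation windows get [n.+1] spare cells. For fixed [n]
    these spare cells cost only a factor exp(- e (n+1)^2), which tends to 1. The rate k+1 arises
    because k+1 individuals are under observation during the [k]-th gap, so the exponent depends on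
    the gaps alone. Each geometric sum then yields a denominator k+1, and the number of histories is
    the product of these denominators. An upper bound would require that every outcome shows some
    pattern, while even the existence of a first birth after the root is not known beforehand. Total
    mass 1 supplies both the laws and the existence of successive births. The convolution giving (1
    - exp(-t))^n is done with Riemann sums squeezed around a telescoping one, so that only
    probabilities of boxes are used. *)

Definition label := seq nat.

(** The root must be excluded because [behead [::] = [::]] would make it its own child. *)
Definition child_of (u v : label) := (v != [::]) && (behead v == u).

Definition children (h : seq label) (u : label) : nat := count (child_of u) h.

(* The possible successions of the first [n] births: the next individual to be
   born is the next child of one of those already born. *)
Fixpoint histories (n : nat) : seq (seq label) :=
  if n is m.+1 then [seq rcons h (children h u :: u) | h <- histories m, u <- h]
  else [:: [:: [::]]].

Section histories_theory.
Implicit Types (h : seq label) (u v : label) (n k : nat).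

Lemma histories_succP n h :
  reflect (exists h' u, [/\ h' \in histories n, u \in h'
                          & h = rcons h' (children h' u :: u)])
          (h \in histories n.+1).
Proof.
apply: (iffP allpairsPdep) => [[h' [u [? ? ->]]]|[h' [u [? ? ->]]]];
  by exists h', u.
Qed.

Lemma size_history n h : h \in histories n -> size h = n.+1.
Proof.
elim: n h => [h|n IH h]; first by rewrite inE => /eqP ->.
by case/histories_succP=> h' [u [/IH sh' _ ->]]; rewrite size_rcons sh'.
Qed.

(** Siblings enter a history in the order 0, 1, 2, ..., so the number of children of [u] is also the
    label of its next one. In particular, the label appended by [histories] is always new. *)
Lemma history_child n h u k : h \in histories n ->
  (k :: u \in h) = (k < children h u)%N.
Proof.
elim: n h u k => [h u k|n IH h u k].
  by rewrite inE => /eqP ->; rewrite inE /children.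
case/histories_succP=> h' [v [h'n vh' ->]].
rewrite mem_rcons in_cons (IH h')// /children -cats1 count_cat /= addn0.
rewrite /child_of /= -/(child_of _) eqseq_cons [v == u]eq_sym.
case: (eqVneq u v) => [->|]; rewrite ?andbF ?andbT ?addn0//.
by rewrite -[in LHS]/(children h' v) -[in RHS]/(children h' v); lia.
Qed.

Lemma uniq_history n h : h \in histories n -> uniq h.
Proof.
elim: n h => [h|n IH h]; first by rewrite inE => /eqP ->.
case/histories_succP=> h' [u [h'n uh' ->]].
by rewrite rcons_uniq (IH _ h'n) andbT (history_child _ _ h'n) ltnn.
Qed.

Lemma uniq_histories n : uniq (histories n).
Proof.
elim: n => [//|n IH]; apply: allpairs_uniq_dep => //.
  by move=> h /uniq_history.
move=> [h u] [h' u'] _ _ /= /rcons_inj[-> _ ->] //.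
Qed.

(** The parent of the next child is any of the individuals already born, which are one more than the
    births so far. *)
Lemma size_histories n : size (histories n) = n`!.
Proof.
elim: n => [//|n IH]; rewrite size_allpairs_dep factS mulnC -IH.
rewrite sumnE big_map (eq_big_seq (fun=> n.+1)) => [|h /size_history //].
by rewrite big_const_seq count_predT iter_addn_0 mulnC.
Qed.

Lemma take_history n h i : h \in histories n -> (i <= n)%N ->
  take i.+1 h \in histories i.
Proof.
elim: n h => [h|n IH h hn].
  by rewrite inE leqn0 => /eqP -> /eqP ->.
rewrite leq_eqVlt => /predU1P[->|].
  by rewrite take_oversize// (size_history hn).
rewrite ltnS => lein.
case/histories_succP: hn => h' [u [h'n uh' ->]].
rewrite -cats1 takel_cat ?(size_history h'n)//; exact: IH.
Qed.

Lemma nth_history0 n h : h \in histories n -> nth [::] h 0 = [::].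
Proof.
move=> hn; have := take_history hn (leq0n n).
by rewrite inE => /eqP; case: h hn => [|v [|? ?]]//= _ [->].
Qed.

Lemma nth_history n h i : h \in histories n -> (i < n)%N ->
  exists2 u, u \in take i.+1 h &
    nth [::] h i.+1 = children (take i.+1 h) u :: u.
Proof.
move=> hn lin; have := take_history hn lin.
case/histories_succP=> h' [u [h'n uh' e]].
have e' : take i.+1 h = h'.
  have : take i.+1 (take i.+2 h) = take i.+1 (rcons h' (children h' u :: u)) by rewrite e.
  rewrite take_takel// => ->.
  by rewrite -cats1 take_cat (size_history h'n) ltnn subnn take0 cats0.
exists u; rewrite e'//.
rewrite -(@nth_take i.+2)// e nth_rcons (size_history h'n) ltnn eqxx//.
Qed.

End histories_theory.

Section counting_facts.
Context {R : realType}.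

Lemma counting_card_eq (T : choiceType) (D : set T) n :
  (D #= `I_n)%card -> counting D = n%:R%:E :> \bar R.
Proof.
move=> Dn; have fD : finite_set D by exists n.
rewrite /counting asboolT//; congr (_%:R%:E).
by apply/card_eq_fsetP; rewrite fset_setK.
Qed.

Lemma counting_infinite (T : choiceType) (D : set T) :
  infinite_set D -> counting D = +oo%E :> \bar R.
Proof. by move=> iD; rewrite /counting asboolF. Qed.

Lemma infinite_downclosed (D : set nat) : infinite_set D ->
  (forall j k, (j <= k)%N -> D k -> D j) -> D = setT.
Proof.
move=> iD Ddown; apply/seteqP; split=> // k _; apply: contrapT => nDk; apply: iD.
apply: (@sub_finite_set _ _ `I_k); last exact: finite_II.
by move=> j Dj /=; rewrite ltnNge; apply/negP => /Ddown /(_ Dj).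
Qed.

Lemma finite_downclosed (D : set nat) : finite_set D ->
  (forall j k, (j <= k)%N -> D k -> D j) -> exists m, D = `I_m.
Proof.
move=> fD Ddown.
have [] := pselect (exists k, ~ D k); last first.
  move=> nD; exfalso; apply: infinite_nat.
  apply: sub_finite_set fD => k _.
  by apply: contrapT => nDk; apply: nD; exists k.
move=> ex; have {ex} : exists k, `[< ~ D k >] by case: ex => k nDk; exists k; apply/asboolP.
move=> /ex_minnP[m /asboolP nDm mmin]; exists m; apply/seteqP; split=> k /=.
  by move=> Dk; rewrite ltnNge; apply/negP => /Ddown /(_ Dk).
by move=> km; apply: contrapT => /asboolP /mmin; rewrite leqNgt km.
Qed.

(** For ordered ages, the number of ages below a level tells which ones they are. This converts
    counts of points into inequalities on single ages. *)
Lemma counting_downclosed (D : set nat) n :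
  (forall j k, (j <= k)%N -> D k -> D j) -> counting D = n%:R%:E :> \bar R ->
  D = `I_n.
Proof.
move=> Ddown; have [fD|iD] := pselect (finite_set D); last first.
  by rewrite counting_infinite.
have [m ->] := finite_downclosed fD Ddown.
by rewrite (counting_card_eq (card_eqxx _)) => -[] /eqP; rewrite eqr_nat => /eqP ->.
Qed.

End counting_facts.

(** * Ages on a grid *)

(** Open on the left, so that the ages [x] in [cell e r] are those with [Num.ceil (x / e)] equal to
    [r.+1]; hence the shift by one in [offspring]. *)
Definition cell {R : realType} (e : R) (r : nat) : set R :=
  `]r%:R * e, r.+1%:R * e]%classic.

Section grid.
Context {R : realType}.
Variables (e : R) (x : nat -> R).
Hypotheses (e0 : 0 < e) (x0 : forall k, 0 < x k)
  (xle : {homo x : j k / (j <= k)%N >-> j <= k}).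

(** The cells up to a grid point partition the ages below it, all ages being positive, so their
    counts add up to an initial segment of indices. *)
Lemma le_grid (c : nat -> nat) (L : nat) :
  (forall r, (r < L)%N -> counting [set k | cell e r (x k)] = (c r)%:R%:E :> \bar R) ->
  forall r k, (r <= L)%N -> (x k <= r%:R * e) = (k < \sum_(s < r) c s)%N.
Proof.
move=> xc r k rL; suff : [set k | x k <= r%:R * e] = `I_(\sum_(s < r) c s)%N.
  move=> /seteqP[le1 le2]; apply/idP/idP; [exact: le1|exact: le2].
apply: (@counting_downclosed R).
  by move=> j k' jk' /=; apply: le_trans; exact: xle.
elim: r rL => [_|r IH rL].
  rewrite big_ord0 (_ : [set _ | _] = set0) ?measure0// -subset0 => j /=.
  by rewrite mul0r leNgt x0.
rewrite (_ : [set _ | _] = [set k | x k <= r%:R * e] `|` [set k | cell e r (x k)]).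
  transitivity (counting [set k | (x k <= r%:R * e)%R]
                + counting [set k | cell e r (x k)] : \bar R)%E.
    apply: measureU => //.
    rewrite -subset0 => j [/= xj]; rewrite /cell/= in_itv/= => /andP[].
    by rewrite ltNge xj.
  rewrite IH 1?ltnW// xc// big_ord_recr/= natrD EFinD//.
have le_e : r%:R * e <= r.+1%:R * e by rewrite ler_pM2r// ler_nat.
apply/seteqP; split=> j /=; rewrite /cell/= in_itv/=.
  by move=> ->; rewrite andbT; have [|] := leP (x j) (r%:R * e); [left|right].
by case=> [/le_trans->//|/andP[]].
Qed.

End grid.

(* The discretised birth time of [v], the [k]-th discretised gap being [d k]. *)
Definition mark (h : seq label) (d : nat -> nat) (v : label) : nat :=
  \sum_(k < index v h) d k.

(* The number of children of [u] to be found in the cell number [r]. *)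
Definition offspring (h : seq label) (d : nat -> nat) (u : label) (r : nat) : nat :=
  count (fun v => child_of u v && (mark h d v == mark h d u + r.+1)%N) h.

(* The last [size h] cells leave room for the rounding errors: a discretised
   birth time exceeds the true one by less than one cell per generation. *)
Definition horizon (h : seq label) (d : nat -> nat) (u : label) : nat :=
  (\sum_(k < (size h).-1) d k - mark h d u + size h)%N.

Section marks.
Variables (n : nat) (h : seq label) (d : nat -> nat).
Hypotheses (hn : h \in histories n) (d0 : forall k, (k < n)%N -> (0 < d k)%N).

Lemma mark_nth i : (i <= n)%N -> mark h d (nth [::] h i) = (\sum_(k < i) d k)%N.
Proof.
by move=> lin; rewrite /mark index_uniq ?(uniq_history hn)// (size_history hn).
Qed.

Lemma sum_gaps_split i j : (i <= j)%N ->
  (\sum_(k < j) d k = \sum_(k < i) d k + \sum_(i <= k < j) d k)%N.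
Proof. by move=> ij; rewrite -!(big_mkord xpredT d) -big_cat_nat. Qed.

Lemma sum_gaps_lt i j : (i < j)%N -> (j <= n)%N ->
  (\sum_(k < i) d k < \sum_(k < j) d k)%N.
Proof.
move=> ij jn; rewrite (sum_gaps_split (ltnW ij)) -addn1 leq_add2l.
rewrite big_ltn// ltn_addr// d0//.
exact: leq_trans ij jn.
Qed.

Lemma leq_sum_gaps i j : (i <= j)%N -> (\sum_(k < i) d k <= \sum_(k < j) d k)%N.
Proof.
by move=> ij; rewrite (sum_gaps_split ij) leq_addr.
Qed.

Lemma sum_gaps_inj i j : (i <= n)%N -> (j <= n)%N ->
  (\sum_(k < i) d k)%N = (\sum_(k < j) d k)%N -> i = j.
Proof.
move=> lin jn e; case: (ltngtP i j) => // ij; exfalso;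
by have := sum_gaps_lt ij; rewrite e ltnn => /(_ ltac:(assumption)).
Qed.

Lemma sum_offspring u r :
  (\sum_(s < r) offspring h d u s)%N =
  count (fun v => child_of u v &&
    (mark h d u < mark h d v <= mark h d u + r)%N) h.
Proof.
elim: r => [|r IH].
  rewrite big_ord0; apply/esym/eqP; rewrite -leqn0 leqNgt -has_count.
  by apply/hasPn => v _; rewrite addn0; apply/negP => /and3P[_]; lia.
rewrite big_ord_recr/= IH /offspring -count_predUI.
rewrite [X in (_ + X)%N](_ : _ = 0)%N; last first.
  apply/eqP; rewrite -leqn0 leqNgt -has_count.
  by apply/hasPn => v _ /=; apply/negP => /andP[/and3P[_ _ ?] /andP[_ /eqP]]; lia.
rewrite addn0; apply: eq_count => v /=; case: child_of => //=; lia.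
Qed.

(** Positive gaps make the marks distinct. Only the counts 0 and 1 therefore occur, for which
    measurability is elementary and the factorial in the Poisson weight is 1. *)
Lemma offspring_le1 u r : (offspring h d u r <= 1)%N.
Proof.
have [/hasP[v vh /andP[vu /eqP mv]]|] := boolP (has (fun v => child_of u v &&
  (mark h d v == mark h d u + r.+1)%N) h); last first.
  by rewrite has_count -leqNgt /offspring => /leq_trans; apply.
apply: (@leq_trans (count_mem v h)); last first.
  by rewrite (count_uniq_mem _ (uniq_history hn)) vh.
rewrite /offspring -!size_filter; apply: uniq_leq_size.
  exact: filter_uniq (uniq_history hn).
move=> v'; rewrite !mem_filter => /andP[/andP[_ /eqP mv'] v'h].
rewrite /= v'h andbT; move: mv'; rewrite -mv.
have : (index v' h <= n)%N by rewrite -ltnS -(size_history hn) index_mem.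
have : (index v h <= n)%N by rewrite -ltnS -(size_history hn) index_mem.
rewrite /mark => iv iv' /(sum_gaps_inj iv' iv).
by move=> /(congr1 (nth [::] h)); rewrite !nth_index// => ->.
Qed.

(** Marks increase strictly along [h], so a bound on the mark is a bound on the position. *)
Lemma count_take_mark (a : pred label) i : (i <= n)%N ->
  count (fun v => a v && (mark h d v <= \sum_(k < i) d k)%N) h = count a (take i.+1 h).
Proof.
move=> lin; have uh := uniq_history hn.
have sh := size_history hn.
rewrite -[X in count _ X](cat_take_drop i.+1) count_cat.
rewrite [X in (_ + X)%N](_ : _ = 0)%N ?addn0; last first.
  apply/eqP; rewrite -leqn0 leqNgt -has_count; apply/hasPn => v vd.
  rewrite negb_and -ltnNge; apply/orP; right.
  have vh : v \in h by apply: mem_drop vd.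
  apply: sum_gaps_lt; last by rewrite -ltnS -sh index_mem.
  rewrite ltnNge; apply/negP; rewrite -ltnS -in_take//= => vt.
  have := uh; rewrite -[h](cat_take_drop i.+1) cat_uniq => /and3P[_ /hasPn/(_ _ vd)].
  by rewrite /= vt.
apply: eq_in_count => v vt; rewrite leq_sum_gaps ?andbT//.
by rewrite -ltnS -in_take// (mem_take vt).
Qed.

Lemma offspring_before i j u : (i < j)%N -> (j <= n)%N -> nth [::] h i = u ->
  (\sum_(s < \sum_(k < j) d k - \sum_(k < i) d k) offspring h d u s)%N =
  children (take j.+1 h) u.
Proof.
move=> ij jn hi; rewrite sum_offspring -hi mark_nth; last exact: leq_trans (ltnW ij) jn.
rewrite subnKC ?leq_sum_gaps 1?ltnW// hi /children -count_take_mark//.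
apply: eq_in_count => v vh; case cv : (child_of u v) => //=.
rewrite [X in X && _](_ : _ = true)//= /mark; apply: sum_gaps_lt.
  move: cv; rewrite /child_of => /andP[vn0 /eqP bv].
  have iv : (index v h <= n)%N by rewrite -ltnS -(size_history hn) index_mem.
  case: (index v h) iv (nth_index [::] vh) => [_|l ln hl].
    by rewrite (nth_history0 hn) => v0; rewrite -v0 eqxx in vn0.
  have [u' u't] := nth_history hn ln; rewrite hl => vE.
  move: bv; rewrite vE /= => bv; subst u'.
  rewrite -[i](index_uniq [::] _ (uniq_history hn)) ?(size_history hn); last first.
    by rewrite ltnS; exact: leq_trans (ltnW ij) jn.
  by rewrite hi -in_take// (mem_take u't).
by rewrite -ltnS -(size_history hn) index_mem.
Qed.

End marks.

(** * What a pattern says about the true birth times *)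

Definition first_births {R : realType} {dT} {T : measurableType dT} (xi : label -> nat -> T -> R)
    (h : seq label) (w : T) :=
  sorted (fun u v => birth_time xi u w < birth_time xi v w) h /\
  forall u v, u \in h -> v \notin h -> birth_time xi u w < birth_time xi v w.

(** Rounding each age upwards, rather than the birth time, gives a value that a pattern determines
    exactly. As it depends on the outcome alone, it recovers the gaps from the outcome and so
    separates patterns. *)
Fixpoint grid_birth {R : realType} {dT} {T : measurableType dT} (xi : label -> nat -> T -> R)
    (e : R) (u : label) (w : T) : int :=
  if u is k :: v then grid_birth xi e v w + Num.ceil (xi v k w / e) else 0.

Definition pattern {R : realType} {dT} {T : measurableType dT} (xi : label -> nat -> T -> R)
    (e : R) (h : seq label) (d : nat -> nat) : set T :=
  [set w | forall u, u \in h -> forall r, (r < horizon h d u)%N ->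
    points_in (xi u) (cell e r) w = (offspring h d u r)%:R%:E].

Section pattern_births.
Context {R : realType} {dT} {T : measurableType dT}.
Variables (xi : label -> nat -> T -> R) (w : T) (e : R).
Hypotheses (e0 : 0 < e) (xi0 : forall u k, 0 < xi u k w).
Hypothesis xile : forall u, {homo (fun k => xi u k w) : j k / (j <= k)%N >-> j <= k}.
Variables (n : nat) (h : seq label) (d : nat -> nat).
Hypotheses (hn : h \in histories n) (d0 : forall k, (k < n)%N -> (0 < d k)%N).
Hypothesis hw : pattern xi e h d w.

Let m i := (\sum_(k < i) d k)%N.
Let b u := birth_time xi u w.

Let le_pattern u r k : u \in h -> (r <= horizon h d u)%N ->
  (xi u k w <= r%:R * e) = (k < \sum_(s < r) offspring h d u s)%N.
Proof.
move=> uh; apply: (@le_grid _ _ (fun k => xi u k w) e0 (xi0 u) (@xile u)) => s sL.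
exact: hw.
Qed.

Let horizonE u : horizon h d u = (m n - mark h d u + n.+1)%N.
Proof. by rewrite /horizon (size_history hn). Qed.

(** By the mark [m i.+1], [k.+1] children of [u] are due, and the last cell before it holds one of
    them. The child number [k] thus lies below the upper grid point but not below the lower one. *)
Let age_bounds i k u : (i < n)%N -> nth [::] h i.+1 = k :: u ->
  (m i.+1 - mark h d u).-1%:R * e < xi u k w <= (m i.+1 - mark h d u)%:R * e.
Proof.
move=> lin hi; have [v vt] := nth_history hn lin; rewrite hi => -[kE uv]; subst v.
have uh : u \in h by exact: mem_take vt.
have pi : (index u h < i.+1)%N by rewrite -in_take.
have pn : (index u h < n)%N by exact: leq_ltn_trans lin.
have mu_lt : (mark h d u < m i.+1)%N by exact: sum_gaps_lt d0 _ _ pi lin.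
have mu_len : (m i.+1 <= m n)%N by exact: leq_sum_gaps.
have mark_i : mark h d (k :: u) = m i.+1 by rewrite -hi (mark_nth _ hn).
have sumE : (\sum_(s < m i.+1 - mark h d u) offspring h d u s)%N = k.+1.
  rewrite (offspring_before hn d0 pi lin (nth_index _ uh)).
  rewrite (take_nth [::]) ?(size_history hn)// hi /children -cats1 count_cat.
  by rewrite -[X in (X + _)%N]kE /= /child_of /= eqxx addn0 addn1.
have off1 : (0 < offspring h d u (m i.+1 - mark h d u).-1)%N.
  rewrite /offspring -has_count; apply/hasP; exists (k :: u).
    by rewrite -hi mem_nth// (size_history hn).
  by rewrite /child_of /= eqxx mark_i prednK ?subn_gt0// subnKC ?eqxx// ltnW.
apply/andP; split; last by rewrite le_pattern ?sumE// horizonE; lia.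
rewrite ltNge le_pattern//; last by rewrite horizonE; lia.
rewrite -leqNgt -ltnS -sumE.
rewrite -[in ltnRHS](prednK (_ : 0 < m i.+1 - mark h d u)%N) ?subn_gt0//.
by rewrite big_ord_recr/= -addn1 leq_add2l.
Qed.

(** Rounding up loses at most one cell per generation, and parents come earlier in [h], so the
    individual at position [i] has generation at most [i]. *)
Lemma pattern_birth i : (i <= n)%N ->
  ((m i)%:R - i%:R) * e <= b (nth [::] h i) <= (m i)%:R * e.
Proof.
elim/ltn_ind: i => -[_ _|i IH lin].
  by rewrite (nth_history0 hn) /b /m big_ord0 !mul0r subrr mul0r /= lexx.
have [u ut hi] := nth_history hn lin.
have uh : u \in h by exact: mem_take ut.
have pi : (index u h < i.+1)%N by rewrite -in_take.
have mu_lt : (mark h d u < m i.+1)%N by exact: sum_gaps_lt d0 _ _ pi lin.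
have := IH _ pi (leq_trans (ltnW pi) lin); rewrite nth_index//.
have /andP[] := age_bounds lin hi.
rewrite hi /b /= -/(b u) -/(mark h d u).
rewrite -[(m (index u h))]/(mark h d u).
set x := xi _ _ _ => x1 x2 /andP[b1 b2].
move: x1 x2; rewrite -subn1 !natrB ?subn_gt0//; last exact: ltnW.
have : (index u h)%:R <= i%:R :> R by rewrite ler_nat.
rewrite -natr1; set p : R := (index u h)%:R; set q : R := (i%:R).
move=> pq x1 x2; have pqe : p * e <= q * e by rewrite ler_pM2r.
apply/andP; split; nra.
Qed.

Lemma pattern_grid_birth i : (i <= n)%N ->
  grid_birth xi e (nth [::] h i) w = (m i)%:Z.
Proof.
elim/ltn_ind: i => -[_ _|i IH lin].
  by rewrite (nth_history0 hn) /m big_ord0.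
have [u ut hi] := nth_history hn lin.
have uh : u \in h by exact: mem_take ut.
have pi : (index u h < i.+1)%N by rewrite -in_take.
have mu_lt : (mark h d u < m i.+1)%N by exact: sum_gaps_lt d0 _ _ pi lin.
have := IH _ pi (leq_trans (ltnW pi) lin); rewrite nth_index//.
have /andP[x1 x2] := age_bounds lin hi.
rewrite hi /= => ->.
rewrite (@ceil_def _ _ (m i.+1 - mark h d u)%N%:Z).
  by rewrite -[m (index u h)]/(mark h d u); lia.
rewrite ltr_pdivlMr// ler_pdivrMr// x2 andbT.
by rewrite -predn_int ?subn_gt0.
Qed.

(** An unlisted child of a listed [v] has an age beyond the horizon of [v]. The true birth of [v]
    may precede its mark by [index v h] cells, which the [n.+1] spare cells of the horizon absorb.
    Descendants of an unlisted individual follow by induction. *)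
Lemma pattern_outside v : v \notin h -> (m n)%:R * e < b v.
Proof.
elim: v => [|k v IH].
  have := mem_nth [::] (_ : 0 < size h)%N; rewrite (nth_history0 hn).
  by rewrite (size_history hn) => ->.
move=> kvh; rewrite /b /= -/(b v).
have [vh|vh] := boolP (v \in h); last by rewrite -[ltLHS]addr0 ltrD ?IH.
have vn : (index v h <= n)%N by rewrite -ltnS -(size_history hn) index_mem.
have /andP[bv _] := pattern_birth vn.
rewrite nth_index// -[m (index v h)]/(mark h d v) in bv.
have mn : (mark h d v <= m n)%N by exact: leq_sum_gaps.
have : ~~ (xi v k w <= (horizon h d v)%:R * e).
  rewrite le_pattern// -leqNgt.
  apply: (@leq_trans (children h v)).
    by rewrite (sum_offspring d hn); apply: sub_count => u /= /andP[].
  by rewrite leqNgt -(history_child _ _ hn).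
rewrite -ltNge horizonE natrD natrB// -natr1.
have : (index v h)%:R <= n%:R :> R by rewrite ler_nat.
move=> pq xL.
have pqe : (index v h)%:R * e <= n%:R * e by rewrite ler_pM2r.
move: bv xL pqe e0; move: (index v h)%:R n%:R (mark h d v)%:R (m n)%:R (b v) (xi v k w).
by move=> p s q r y x *; lra.
Qed.

(** A gap of more than [n] cells exceeds the rounding error of any listed birth time, so the true
    order is that of the marks. *)
Lemma pattern_first_births : (forall k, (k < n)%N -> (n < d k)%N) ->
  first_births xi h w.
Proof.
move=> dn; split.
  apply/(sortedP [::]) => i; rewrite (size_history hn) ltnS => lin.
  have /andP[_ b1] := pattern_birth (ltnW lin).
  have /andP[b2 _] := pattern_birth lin.
  rewrite -/(b _) -/(b _); apply: le_lt_trans b1 (lt_le_trans _ b2).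
  rewrite ltr_pM2r// /m big_ord_recr/= natrD -addrA ltrDl subr_gt0 ltr_nat.
  exact: leq_trans (dn _ lin).
move=> u v uh vh; apply: le_lt_trans (pattern_outside vh).
have iu : (index u h <= n)%N by rewrite -ltnS -(size_history hn) index_mem.
rewrite -(nth_index [::] uh) -/(b _).
have /andP[_ /le_trans] := pattern_birth iu; apply.
by rewrite ler_pM2r// ler_nat leq_sum_gaps.
Qed.

Lemma pattern_gap k : (k < n)%N ->
  ((d k)%:R - n%:R) * e <= b (nth [::] h k.+1) - b (nth [::] h k) <=
  ((d k)%:R + n%:R) * e.
Proof.
move=> kn; have /andP[b1 b2] := pattern_birth (ltnW kn).
have /andP[b3 b4] := pattern_birth kn.
have mE : (m k.+1)%:R = (m k)%:R + (d k)%:R :> R by rewrite /m big_ord_recr/= natrD.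
have : (k.+1%:R) * e <= n%:R * e by rewrite ler_pM2r// ler_nat.
have : (k%:R) * e <= n%:R * e by rewrite ler_pM2r// ler_nat ltnW.
by rewrite mE in b3 b4 *; move=> ? ?; apply/andP; split; lra.
Qed.

End pattern_births.

(** * Probability of a pattern *)

Section counting01.
Context {R : realType} {T : choiceType}.

Lemma counting_eq0 (D : set T) : counting D = 0%:R%:E :> \bar R -> D = set0.
Proof.
have [fD|iD] := pselect (finite_set D); last by rewrite counting_infinite.
rewrite /counting asboolT// => -[] /eqP; rewrite eqr_nat => /eqP/cardfs0_eq.
by move=> /(congr1 (fun A : {fset T} => [set` A])); rewrite fset_setK// set_fset0.
Qed.

Lemma counting_eq1 (D : set T) :
  counting D = 1%:R%:E :> \bar R -> exists k, D = [set k].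
Proof.
have [fD|iD] := pselect (finite_set D); last by rewrite counting_infinite.
rewrite /counting asboolT// => -[] /eqP; rewrite eqr_nat => /cardfs1P[k Dk].
by exists k; rewrite -(fset_setK fD) Dk set_fset1.
Qed.

End counting01.

Section rate_one_intensity.
Context {R : realType}.

Lemma Gamma1 : Gamma (1 : R) = 1.
Proof.
rewrite /Gamma /Rintegral.
rewrite (_ : (\int[_]_(x in _) _)%E = 1%E)//.
rewrite -(@integral_exponential_pdf R 1 ltr01).
rewrite -(setUv `]0%R, +oo[%classic) ge0_integral_setU//=; last 4 first.
- exact: measurableC.
- rewrite setUv; apply/measurable_EFinP; exact: measurable_exponential_pdf.
- by move=> x _; rewrite lee_fin exponential_pdf_ge0.
- exact/disj_setPCl.
rewrite [X in (_ = _ + X)%E](_ : _ = 0%E) ?adde0; last first.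
  rewrite (_ : ~` _ = `]-oo, 0%R]%classic); last first.
    by apply/seteqP; split=> x /=; rewrite !in_itv/= andbT leNgt => /negP.
  rewrite -(integral_itv_bndo_bndc (a := -oo%O) (r := 0 : R)); last first.
    by apply/measurable_EFinP; apply: measurable_funTS; exact: measurable_exponential_pdf.
  apply: integral0_eq => x /=; rewrite in_itv/= => x0.
  by rewrite lt0_exponential_pdf.
apply: eq_integral => x; rewrite inE/= in_itv/= andbT => x0.
by rewrite subrr powRr0 mul1r exponential_pdfE ?ltW// mul1r mulN1r.
Qed.

Lemma intensity1 (A : set R) : measurable A ->
  intensity 1 A = lebesgue_measure (A `&` `]0, +oo[%classic).
Proof.
move=> mA; rewrite /intensity Gamma1.
under eq_integral do rewrite subrr powRr0 divr1.
by rewrite integral_cst ?mul1e//; exact: measurableI.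
Qed.

Lemma intensity1_cell (e : R) r : 0 < e -> intensity 1 (cell e r) = e%:E.
Proof.
move=> e0; rewrite intensity1 ?/cell//.
rewrite (_ : _ `&` _ = cell e r).
  rewrite /cell lebesgue_measure_itv/= lte_fin ltr_pM2r// ltr_nat ltnSn.
  by rewrite -EFinB -mulrBl -natrB// subSnn mul1r.
apply/setIidPl => x; rewrite /cell/= !in_itv/= andbT => /andP[+ _].
by apply: le_lt_trans; rewrite mulr_ge0// ltW.
Qed.

Lemma intensity1_le0 : intensity 1 (`]-oo, 0%R]%classic : set R) = 0%E.
Proof.
rewrite intensity1// (_ : _ `&` _ = set0) ?measure0// -subset0 => x [/=].
by rewrite !in_itv/= andbT leNgt => /negP.
Qed.

End rate_one_intensity.

Section points_in_measurable.
Context {R : realType} {dT} {T : measurableType dT}.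
Variables (X : nat -> T -> R) (A : set R) (S : set (set T)).
Hypotheses (sS : sigma_algebra setT S) (XS : forall k, S (X k @^-1` A)).

Let SI B C : S B -> S C -> S (B `&` C).
Proof.
case: sS => S0 SC SU SB SC'.
rewrite (_ : _ `&` _ = ~` (\bigcup_k (if k is 0%N then ~` B else ~` C))).
  by rewrite -setTD; apply/SC/SU => -[|k]; rewrite -setTD; apply: SC.
rewrite setC_bigcup; apply/seteqP; split=> w /=.
  by case=> Bw Cw [|k] _ /= nw; exact: nw.
by move=> H; split; [apply: contrapT; exact: (H 0%N I)|apply: contrapT; exact: (H 1%N I)].
Qed.

(** The sigma-algebra [S] is arbitrary because independence between individuals is assumed for the
    sigma-algebras generated by their ages; measurability in [T] would not suffice. *)
Lemma sigma_points_in0 : S [set w | points_in X A w = 0%:R%:E].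
Proof.
case: sS => S0 SC SU.
rewrite (_ : [set _ | _] = setT `\` \bigcup_k (X k @^-1` A)); first exact/SC/SU.
rewrite setTD; apply/seteqP; split=> w /=.
  by move=> /counting_eq0 w0 [k _ Xk]; have : set0 k by rewrite -w0.
move=> nX; rewrite /points_in (_ : [set _ | _] = set0).
  by apply: counting_card_eq; rewrite II0 card_eqxx.
by rewrite -subset0 => k Xk; apply: nX; exists k.
Qed.

Lemma sigma_points_in1 : S [set w | points_in X A w = 1%:R%:E].
Proof.
case: sS => S0 SC SU.
rewrite (_ : [set _ | _] = \bigcup_k (X k @^-1` A `&`
    (setT `\` \bigcup_j (if j == k then set0 else X j @^-1` A)))).
  apply: (SU) => k; apply: SI => //; apply: SC; apply: SU => j.
  by case: ifP.
apply/seteqP; split=> w /=.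
  move=> /counting_eq1[k Dk]; exists k => //; split.
    by have : [set k] k by []; rewrite -Dk.
  rewrite setTD => -[j _]; case: eqVneq => // /eqP jk Xj; apply: jk.
  by have : [set k] j by rewrite -Dk.
case=> k _ [Xk]; rewrite setTD /= => nX.
rewrite /points_in (_ : [set _ | _] = [set k]).
  by apply: counting_card_eq; exact: card_set1.
apply/seteqP; split=> [j /= Xj|j ->//]; apply: contrapT => /eqP jk.
by apply: nX; exists j => //; rewrite (negPf jk).
Qed.

End points_in_measurable.

Lemma independent_classes_seq d (T : measurableType d) (R : realType)
    (P : probability T R) (I : choiceType) (C : I -> set (set T))
    (s : seq I) (A : I -> set T) :
  independent_classes P C -> uniq s -> (forall i, i \in s -> C i (A i)) ->
  P (\bigcap_(i in [set` s]) A i) = (\prod_(i <- s) P (A i))%E.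
Proof.
move=> iC us CA; have := iC [fset i in s]%fset A.
have -> : [set` [fset i in s]%fset] = [set` s].
  by apply/seteqP; split=> i /=; rewrite inE.
move=> ->; last by move=> i; rewrite inE; exact: CA.
apply: perm_big; apply: uniq_perm => //.
by move=> i; rewrite inE.
Qed.

Lemma trivIset_cell (R : realType) (e : R) : 0 < e -> trivIset setT (cell e).
Proof.
move=> e0 r s _ _ [x []]; rewrite /cell/= !in_itv/= => /andP[r1 r2] /andP[s1 s2].
have := lt_le_trans r1 s2; have := lt_le_trans s1 r2.
by rewrite !ltr_pM2r// !ltr_nat; lia.
Qed.

(** Summation by parts: the [k]-th gap is watched by the [k.+1] individuals already born, which is
    the source of the rate [k.+1]. The square collects the [n.+1] spare cells of [n.+1] individuals.
    The total does not depend on the history. *)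
Lemma sum_horizon n h d : h \in histories n ->
  (\sum_(u <- h) horizon h d u = \sum_(k < n) k.+1 * d k + n.+1 ^ 2)%N.
Proof.
move=> hn; have sh := size_history hn.
have -> : (\sum_(u <- h) horizon h d u =
    \sum_(i < n.+1) (\sum_(k < n) d k - \sum_(k < i) d k + n.+1))%N.
  rewrite (big_nth [::]) sh big_mkord; apply: eq_bigr => i _.
  by rewrite /horizon (mark_nth _ hn) ?sh// -ltnS.
rewrite big_split/= sum_nat_const card_ord -mulnn; congr addn.
elim: n {hn sh} => [|n IH]; first by rewrite big_ord1 !big_ord0.
rewrite big_ord_recr/= subnn addn0 [RHS]big_ord_recr/= -IH.
transitivity (\sum_(i < n.+1) (\sum_(k < n) d k - \sum_(k < i) d k + d n))%N.
  apply: eq_bigr => i _; rewrite big_ord_recr/= addnC -addnBA 1?addnC//.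
  by apply: leq_sum_gaps; rewrite -ltnS.
by rewrite big_split/= sum_nat_const card_ord.
Qed.

(** Counted from the children instead: the root has no parent and every other entry at most one in
    [h]. The inequality suffices because powers of [e <= 1] decrease. *)
Lemma sum_children_le n h : h \in histories n -> (\sum_(u <- h) children h u <= n)%N.
Proof.
move=> hn; have uh := uniq_history hn.
have -> : (\sum_(u <- h) children h u = \sum_(v <- h) count (child_of^~ v) h)%N.
  rewrite /children; under eq_bigr do rewrite -sum1_count big_mkcond.
  rewrite exchange_big/=; apply: eq_bigr => v _.
  by rewrite -sum1_count [RHS]big_mkcond.
case: h hn uh => [|v h] hn uh; first by rewrite big_nil.
have v0 : v = [::] := nth_history0 hn.
have [<-] : (size h).+1 = n.+1 := size_history hn.
rewrite big_cons [X in (X + _)%N](_ : _ = 0)%N; last first.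
  by apply/eqP; rewrite -leqn0 leqNgt -has_count v0; apply/hasPn.
rewrite add0n -sum1_size; apply: leq_sum => w _.
apply: (@leq_trans (count_mem (behead w) (v :: h))).
  by apply: sub_count => u /= /andP[_ /eqP ->].
by rewrite count_uniq_mem//; case: (_ \in _).
Qed.

Section pattern_probability.
Context {R : realType} {dT} {T : measurableType dT} (P : probability T R).
Variable xi : label -> nat -> {RV P >-> R}.
Hypothesis hxi : cmj_process 1 xi.

Let ages u k : T -> R := xi u k.

Let points_event u A c : set T := [set w | points_in (ages u) A w = c%:R%:E].

Let sub_measurable u : <<s \bigcup_k sigma_rv (xi u k) >> `<=` measurable.
Proof.
apply: smallest_sub; first exact: sigma_algebra_measurable.
move=> _ [k _ [B mB <-]]; rewrite setTI -[_ @^-1` _]setTI.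
exact: measurable_funP.
Qed.

Let sigma_points_event u A c : measurable A -> (c <= 1)%N ->
  <<s \bigcup_k sigma_rv (xi u k) >> (points_event u A c).
Proof.
move=> mA; have sS : sigma_algebra setT <<s \bigcup_k sigma_rv (xi u k) >>.
  exact: smallest_sigma_algebra.
have SA k : <<s \bigcup_k sigma_rv (xi u k) >> (ages u k @^-1` A).
  by apply: sub_sigma_algebra; exists k => //; exists A; rewrite ?setTI.
by case: c => [|[|//]] _; [exact: sigma_points_in0|exact: sigma_points_in1].
Qed.

(** The half-line of nonpositive ages has intensity 0, where the Poisson law is the Dirac mass at 0.
    Labels are enumerated through [pickle] to intersect countably many almost sure events. *)
Lemma ages_ae : {ae P, forall w, (forall u k, 0 < xi u k w) /\
  (forall u, {homo (fun k => xi u k w) : j k / (j <= k)%N >-> j <= k})}.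
Proof.
pose lab (i : nat) : label := odflt [::] (@choice.unpickle (seq nat) i).
have labK u : exists i, lab i = u.
  by exists (@choice.pickle (seq nat) u); rewrite /lab choice.pickleK.
have pos i : \forall w \ae P, forall k, 0 < xi (lab i) k w.
  set u := lab i; have mA : measurable (`]-oo, 0%R]%classic : set R) by [].
  have mE := sub_measurable (@sigma_points_event u _ 0%N mA isT).
  exists (~` points_event u `]-oo, 0%R]%classic 0); split.
  - exact: measurableC.
  - rewrite probability_setC// [P _](_ : _ = 1%E) ?subee//.
    have [+ _] := cmj_poisson hxi u => /(_ `]-oo, 0%R]%classic mA).
    rewrite intensity1_le0 => /(_ (ltry 0) 0%N) ->.
    by rewrite /poisson_prob ltxx diracE mem_set.
  - move=> w /=; apply: contra_not => /counting_eq0 w0 k.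
    rewrite ltNge; apply/negP => wk.
    by have : set0 k by rewrite -w0 /=; rewrite in_itv/=.
have mono i : \forall w \ae P,
    {homo (fun k => xi (lab i) k w) : j k / (j <= k)%N >-> j <= k}.
  exact: (cmj_ordered hxi (lab i)).
have := ae_foralln pos; have := ae_foralln mono.
apply: filterS2 => w wmono wpos; split.
  by move=> u k; have [i <-] := labK u; exact: wpos.
by move=> u; have [i <-] := labK u; exact: wmono.
Qed.

Let individual e h d u : set T :=
  \bigcap_(r in [set` iota 0 (horizon h d u)])
    points_event u (cell e r) (offspring h d u r).

Let patternE e h d : pattern ages e h d = \bigcap_(u in [set` h]) individual e h d u.
Proof.
apply/seteqP; split=> w H u uh r.
  by rewrite /= mem_iota add0n => rL; exact: H.
by move=> rL; apply: (H u uh r); rewrite /= mem_iota add0n.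
Qed.

Let sigma_individual n e h d u : h \in histories n ->
  (forall k, (k < n)%N -> (0 < d k)%N) ->
  <<s \bigcup_k sigma_rv (xi u k) >> (individual e h d u).
Proof.
move=> hn d0; rewrite /individual bigcap_seq.
apply: big_ind => [|A B|r _].
- exact: (@measurableT _ (g_sigma_algebraType _)).
- exact: (@measurableI _ (g_sigma_algebraType _)).
- by apply: sigma_points_event; rewrite ?(offspring_le1 hn d0)// /cell.
Qed.

Lemma measurable_pattern n e h d : h \in histories n ->
  (forall k, (k < n)%N -> (0 < d k)%N) -> measurable (pattern ages e h d).
Proof.
move=> hn d0; rewrite patternE bigcap_seq; apply: bigsetI_measurable => u _.
by apply: sub_measurable; exact: sigma_individual hn d0.
Qed.

(** A cell has Poisson mean [e], hence weight exp(- e), times [e] if it holds a point. The power of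
    [e] counts the recorded births and the exponential counts the cells observed. *)
Lemma pattern_probability n e h d : 0 < e <= 1 -> h \in histories n ->
  (forall k, (k < n)%N -> (0 < d k)%N) ->
  ((e ^+ n * expR (- (e * (\sum_(k < n) k.+1 * d k + n.+1 ^ 2)%N%:R)))%:E
    <= P (pattern ages e h d))%E.
Proof.
move=> /andP[e0 e1] hn d0; rewrite patternE.
rewrite (independent_classes_seq (cmj_independent hxi) (uniq_history hn)); last first.
  by move=> u _; exact: sigma_individual hn d0.
have PE u : P (individual e h d u) =
    (\prod_(r <- iota 0 (horizon h d u)) (e ^+ offspring h d u r * expR (- e)))%:E.
  have [pois indep] := cmj_poisson hxi u.
  rewrite (independent_classes_seq (indep _ _ (trivIset_cell e0))) ?iota_uniq//.
  - rewrite -prodEFin; apply: eq_bigr => r _.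
    rewrite pois ?intensity1_cell ?ltry ?/cell//.
    rewrite /poisson_prob /= e0 esum_set1 ?lee_fin ?poisson_pmf_ge0//.
    rewrite /poisson_pmf e0.
    suff -> : ((offspring h d u r)`! = 1)%N by rewrite divr1.
    by have := offspring_le1 hn d0 u r; case: offspring => [|[|//]].
  - by move=> r; rewrite /cell.
  - move=> r _; exists [set (offspring h d u r)%:R%:E]; last by rewrite setTI.
    exact: emeasurable_set1.
rewrite (eq_bigr _ (fun u _ => PE u)) prodEFin lee_fin.
have -> : \prod_(u <- h) \prod_(r <- iota 0 (horizon h d u))
      (e ^+ offspring h d u r * expR (- e)) =
    e ^+ (\sum_(u <- h) \sum_(r < horizon h d u) offspring h d u r)%N *
    expR (- (e * (\sum_(u <- h) horizon h d u)%N%:R)).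
  rewrite expr_sum natr_sum mulr_sumr -sumrN expR_sum -big_split/=.
  apply: eq_bigr => u _; rewrite big_split/= expr_sum; congr (_ * _).
    by rewrite -[RHS](big_mkord xpredT (fun r => e ^+ offspring h d u r)) /index_iota subn0.
  rewrite -[horizon _ _ _ in LHS]subn0 -/(index_iota 0 _) prodr_const_nat subn0.
  by rewrite -expRM_natl mulrN mulrC.
rewrite (sum_horizon d hn) ler_wpM2r ?expR_ge0// ler_wiXn2l// ?(ltW e0)//.
apply: leq_trans (sum_children_le hn); apply: leq_sum => u _.
by rewrite (sum_offspring d hn); apply: sub_count => v /= /andP[].
Qed.

End pattern_probability.

(** * Times between consecutive births *)

(** An enumeration by integers of all lists of [n.+1] distinct labels, so that the infimum in
    [nth_birth] is countable and hence measurable. Codes of anything else fall back on children of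
    the root, which form such a list too. *)
Definition birth_list (n i : nat) : seq label :=
  if choice.unpickle i is Some h then
    if (size h == n.+1) && uniq h then h else [seq [:: k] | k <- iota 0 n.+1]
  else [seq [:: k] | k <- iota 0 n.+1].

Section birth_order.
Context {R : realType} {dT} {T : measurableType dT}.
Variable xi : label -> nat -> {mfun T >-> R}.

Let b (u : label) (w : T) : R := birth_time (fun u k => xi u k) u w.

Definition last_birth (h : seq label) (w : T) : R := \big[Num.max/0]_(u <- h) b u w.

(* The time of the [n]-th birth, the root being counted as number 0: at least
   [n.+1] individuals are born by time [t] iff some [n.+1] distinct ones are. *)
Definition nth_birth (n : nat) (w : T) : R :=
  infs (fun i => last_birth (birth_list n i) w) 0.

Definition interbirth (n : nat) (w : T) : R := nth_birth n.+1 w - nth_birth n w.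

Lemma measurable_birth_time u : measurable_fun setT (b u).
Proof.
rewrite /b; elim: u => [|k u IH] /=; first exact: measurable_cst.
exact: measurable_funD.
Qed.

Lemma last_birth_ge0 h w : 0 <= last_birth h w.
Proof.
rewrite /last_birth; elim: h => [|u h IH]; first by rewrite big_nil.
by rewrite big_cons le_max IH orbT.
Qed.

Lemma le_last_birth h u w : u \in h -> b u w <= last_birth h w.
Proof.
rewrite /last_birth; elim: h => // v h IH; rewrite inE big_cons le_max.
by case/predU1P => [->|/IH ->]; rewrite ?lexx ?orbT.
Qed.

Lemma measurable_last_birth h : measurable_fun setT (last_birth h).
Proof.
rewrite /last_birth; elim: h => [|u h IH].
  by under eq_fun do rewrite big_nil; exact: measurable_cst.
under eq_fun do rewrite big_cons; apply: measurable_maxr => //.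
exact: measurable_birth_time.
Qed.

Lemma measurable_nth_birth n : measurable_fun setT (nth_birth n).
Proof.
apply: measurable_fun_infs => [w _|i _]; last exact: measurable_last_birth.
by exists 0 => _ [i _ <-]; exact: last_birth_ge0.
Qed.

Lemma measurable_interbirth n : measurable_fun setT (interbirth n).
Proof. by apply: measurable_funB; exact: measurable_nth_birth. Qed.

HB.instance Definition _ n :=
  isMeasurableFun.Build _ _ _ _ (interbirth n) (measurable_interbirth n).

Lemma birth_listP n i : size (birth_list n i) = n.+1 /\ uniq (birth_list n i).
Proof.
have dflt : size [seq [:: k] | k <- iota 0 n.+1] = n.+1 /\
    uniq [seq [:: k] | k <- iota 0 n.+1].
  by rewrite size_map size_iota map_inj_uniq ?iota_uniq// => k l [].
rewrite /birth_list; case: choice.unpickle => // h.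
by case: ifP => // /andP[/eqP].
Qed.

Lemma birth_list_surj n h : size h = n.+1 -> uniq h -> exists i, birth_list n i = h.
Proof.
move=> sh uh; exists (choice.pickle h).
by rewrite /birth_list choice.pickleK sh eqxx uh.
Qed.

Lemma first_births_uniq h w : first_births (fun u k => xi u k) h w -> uniq h.
Proof.
case=> sh _; apply: sorted_uniq sh => [u v w'|u]; last by rewrite ltxx.
exact: lt_trans.
Qed.

Lemma first_births_le h w i j : first_births (fun u k => xi u k) h w ->
  (i <= j)%N -> (j < size h)%N -> b (nth [::] h i) w <= b (nth [::] h j) w.
Proof.
case=> sh _; rewrite leq_eqVlt => /predU1P[->//|ij jh]; apply: ltW.
apply: (sorted_ltn_nth _ [::] sh) => //; rewrite ?inE//.
  by move=> u v w'; exact: lt_trans.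
exact: ltn_trans jh.
Qed.

(** The first [n.+1] entries of [h] attain the infimum. Conversely, by the pigeonhole principle, any
    [n.+1] distinct labels include one outside the first [n] entries of [h], and it is born no
    earlier than entry [n]. *)
Lemma nth_birthE h w n : (forall u, 0 <= b u w) ->
  first_births (fun u k => xi u k) h w -> (n < size h)%N ->
  nth_birth n w = b (nth [::] h n) w.
Proof.
move=> b0 fh nh; have uh := first_births_uniq fh.
have [sh later] := fh.
apply/eqP; rewrite eq_le; apply/andP; split.
  have st : size (take n.+1 h) = n.+1 by rewrite size_takel.
  have [i hi] := birth_list_surj st (take_uniq _ uh).
  apply: (@le_trans _ _ (last_birth (take n.+1 h) w)).
    apply: ge_inf; last by exists i => //; rewrite hi.
    by exists 0 => _ [j _ <-]; exact: last_birth_ge0.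
  rewrite /last_birth big_seq; apply: (big_ind (fun x => x <= b (nth [::] h n) w)) => //.
    by move=> x y xb yb; rewrite ge_max xb.
  move=> u ut; rewrite -(nth_index [::] (mem_take ut)).
  by apply: first_births_le fh _ nh; rewrite -ltnS -in_take// (mem_take ut).
apply: lb_le_inf; first by exists (last_birth (birth_list n 0) w), 0%N.
move=> _ [i _ <-]; have [si ui] := birth_listP n i.
have [v vi vh] : exists2 v, v \in birth_list n i & v \notin take n h.
  apply/hasP; rewrite has_predC; apply/negP => /allP sub.
  by have := uniq_leq_size ui sub; rewrite si (size_takel (ltnW nh)) ltnn.
apply: le_trans (le_last_birth _ vi).
have [vinh|vnh] := boolP (v \in h); last first.
  by apply/ltW/later => //; exact: mem_nth.
rewrite -[v in leRHS](nth_index [::] vinh); apply: first_births_le fh _ _.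
  by rewrite leqNgt -in_take.
by rewrite index_mem.
Qed.

End birth_order.

(** Gaps from [grid_lo] up to but excluding [grid_hi] keep the true gap in the interval from [a] to
    [b] despite the error of [n] cells in [pattern_gap]. Moreover [grid_lo] exceeds [n], as the
    ordering of births requires. *)
Definition grid_lo {R : realType} (e a : R) (n : nat) : nat := (n + (Num.truncn (a / e)).+1)%N.
Definition grid_hi {R : realType} (e b : R) (n : nat) : nat := ((Num.truncn (b / e)).+1 - n)%N.

Lemma grid_lo_gap (R : realType) (e a : R) (n d : nat) : 0 < e -> 0 <= a ->
  (grid_lo e a n <= d)%N -> a < (d%:R - n%:R) * e.
Proof.
move=> e0 a0; rewrite /grid_lo => nd; have /andP[_ ae] := truncn_itv (divr_ge0 a0 (ltW e0)).
rewrite -ltr_pdivrMr//; apply: lt_le_trans ae _.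
by rewrite lerBrDr -natrD ler_nat addnC.
Qed.

Lemma grid_hi_gap (R : realType) (e b : R) (n d : nat) : 0 < e -> 0 <= b ->
  (d < grid_hi e b n)%N -> (d%:R + n%:R) * e <= b.
Proof.
move=> e0 b0; rewrite /grid_hi => nd; have /andP[be _] := truncn_itv (divr_ge0 b0 (ltW e0)).
rewrite -ler_pdivlMr//; apply: le_trans be.
by rewrite -natrD ler_nat; move: (Num.truncn _) nd => t; lia.
Qed.

Section geometric_sum.
Context {R : realType}.
Variables (e lambda a b : R) (n : nat).
Hypotheses (e0 : 0 < e) (lambda0 : 0 < lambda) (a0 : 0 <= a) (b0 : 0 <= b).

(** Since 1 - exp(- lambda e) <= lambda e, each term is at least a difference of consecutive
    exponentials divided by [lambda], and these telescope. The maximum with 0 covers an empty range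
    of summation. *)
Lemma geometric_lower_bound :
  Num.max 0 (expR (- (lambda * (a + e * n.+1%:R))) - expR (- (lambda * (b - e * n%:R)))) / lambda
  <= \sum_(grid_lo e a n <= d < grid_hi e b n) e * expR (- (e * (lambda * d%:R))).
Proof.
have sum0 : 0 <= \sum_(grid_lo e a n <= d < grid_hi e b n) e * expR (- (e * (lambda * d%:R))).
  by apply: sumr_ge0 => d _; rewrite mulr_ge0 ?expR_ge0// ltW.
have le_lo : e * (grid_lo e a n)%:R <= a + e * n.+1%:R.
  rewrite /grid_lo; have /andP[ae _] := truncn_itv (divr_ge0 a0 (ltW e0)).
  rewrite addnS -addSn natrD mulrDr addrC lerD2r mulrC -ler_pdivlMr//.
have le_hi : b - e * n%:R <= e * (grid_hi e b n)%:R.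
  rewrite /grid_hi; have /andP[_ /ltW be] := truncn_itv (divr_ge0 b0 (ltW e0)).
  rewrite lerBlDr -mulrDr -natrD -ler_pdivrMl// mulrC; apply: le_trans be _.
  by rewrite ler_nat; move: (Num.truncn _) => t; lia.
pose g (d : nat) : R := expR (- (lambda * (e * d%:R))).
have telescoped : (g (grid_lo e a n) - g (grid_hi e b n)) / lambda <=
    \sum_(grid_lo e a n <= d < grid_hi e b n) e * expR (- (e * (lambda * d%:R))).
  have [lohi|/ltnW hilo] := leqP (grid_lo e a n) (grid_hi e b n); last first.
    apply: le_trans sum0; rewrite pmulr_lle0 ?invr_gt0// subr_le0.
    by rewrite ler_expR lerN2 !ler_pM2l// ler_nat.
  rewrite ler_pdivrMr// mulr_suml -opprB -telescope_sumr// -sumrN.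
  apply: ler_sum => d _; rewrite opprB /g.
  have -> : e * (lambda * d%:R) = lambda * (e * d%:R) by ring.
  rewrite -natr1 !mulrDr mulr1 opprD expRD.
  set E := expR (- (lambda * (e * d%:R))).
  have := expR_ge1Dx (- (lambda * e)).
  have : 0 <= E by rewrite expR_ge0.
  set F := expR _; move: E F => E F E0 F0; nra.
rewrite ler_pdivrMr// ge_max (mulr_ge0 sum0 (ltW lambda0))/= -ler_pdivrMr//.
apply: le_trans telescoped.
rewrite ler_pM2r ?invr_gt0//; apply: lerB; rewrite ler_expR lerN2 ler_pM2l//.
Qed.

End geometric_sum.

Lemma le_sum_measure d (T : measurableType d) (R : realType)
    (mu : {measure set T -> \bar R}) (I : eqType) (s : seq I) (F : I -> set T)
    (U : set T) :
  uniq s -> measurable U -> (forall i, i \in s -> measurable (F i)) ->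
  (forall i, i \in s -> F i `<=` U) ->
  (forall i j, i \in s -> j \in s -> F i `&` F j !=set0 -> i = j) ->
  (\sum_(i <- s) mu (F i) <= mu U)%E.
Proof.
move=> + + + + +; elim: s U => [|i s IH] U; first by rewrite big_nil measure_ge0.
rewrite cons_uniq => /andP[si us] mU mF FU dF; rewrite big_cons.
have mFi : measurable (F i) by apply: mF; rewrite mem_head.
have -> : mu U = (mu (F i) + mu (U `\` F i))%E.
  rewrite -[in LHS](setDUK (FU i (mem_head _ _))) measureU ?setDIK//.
  exact: measurableD.
apply: leeD2l; apply: IH => //.
- exact: measurableD.
- by move=> j js; apply: mF; rewrite inE js orbT.
- move=> j js w Fjw; split; first by apply: (FU j) => //; rewrite inE js orbT.
  move=> Fiw; move: si; suff -> : i = j by rewrite js.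
  by apply: dF; rewrite ?inE ?eqxx ?js ?orbT//; exists w.
- by move=> j k js ks; apply: dF; rewrite inE ?js ?ks orbT.
Qed.

Section gaps_lower_bound.
Context {R : realType} {dT} {T : measurableType dT} (P : probability T R).
Variable xi : label -> nat -> {RV P >-> R}.
Hypothesis hxi : cmj_process 1 xi.

Let ages u k : T -> R := xi u k.
Let b u w : R := birth_time ages u w.

Lemma birth_time_ge0 w : (forall u k, 0 < xi u k w) -> forall u, 0 <= b u w.
Proof.
move=> xi0; rewrite /b; elim=> [|k u IH] //=.
by rewrite addr_ge0// ltW// xi0.
Qed.

(** If each list had a member missing from the other, each of these two would be born before the
    other. So the members agree, and strict sorting fixes the order. *)
Lemma first_births_eq h h' w : first_births ages h w -> first_births ages h' w ->
  size h = size h' -> h = h'.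
Proof.
move=> fh fh' shh'.
have uh := first_births_uniq fh; have uh' := first_births_uniq fh'.
suff hh' : h =i h'.
  apply: (@irr_sorted_eq _ (fun u v => b u w < b v w)) => //.
  - by move=> u v v'; exact: lt_trans.
  - exact: fh.1.
  - exact: fh'.1.
have [sub|/allPn[v vh vh']] := boolP (all (mem h') h).
  move/allP in sub; have [] := uniq_min_size uh sub; first by rewrite shh'.
  by move=> _ e v; rewrite e.
have [sub'|/allPn[v' v'h' v'h]] := boolP (all (mem h) h').
  move/allP in sub'; have [] := uniq_min_size uh' sub'; first by rewrite shh'.
  by move=> _ e u; rewrite e.
have := lt_trans (fh.2 _ _ vh v'h) (fh'.2 _ _ v'h' vh').
by rewrite ltxx.
Qed.

(** The event [U] is a finite union of patterns, hence measurable, and it carries both the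
    constraints on the gaps and the existence of a history. The same bound thus serves for the laws
    and for [histories_ae]. *)
Lemma gaps_lower_bound n e (lo hi : nat -> R) : 0 < e <= 1 ->
  (forall k, 0 <= lo k) -> (forall k, 0 <= hi k) ->
  exists2 U, measurable U /\
    (forall w, U w -> (forall u k, 0 < xi u k w) /\
       (exists2 h, h \in histories n & first_births ages h w) /\
       forall k, (k < n)%N -> lo k < interbirth xi k w <= hi k) &
    ((expR (- (e * (n.+1 ^ 2)%N%:R)) *
      \prod_(k < n) Num.max 0 (expR (- (k.+1%:R * (lo k + e * n.+1%:R)))
                    - expR (- (k.+1%:R * (hi k - e * n%:R)))))%:E <= P U)%E.
Proof.
move=> /[dup] e01 /andP[e0 e1] lo0 hi0.
(* A common bound makes the gap sequences a finite type, over which a product of sums can be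
   expanded. *)
pose N := (\max_(k < n) grid_hi e (hi k) n)%N.
pose ext (f : {ffun 'I_n -> 'I_N}) (k : nat) : nat := oapp (fun i => val (f i)) 0%N (insub k).
have extE f (i : 'I_n) : ext f i = f i by rewrite /ext valK.
pose Q (i : 'I_n) : {pred 'I_N} :=
  [pred j : 'I_N | (grid_lo e (lo i) n <= j < grid_hi e (hi i) n)%N].
have extQ f k : f \in family Q -> (k < n)%N ->
    (grid_lo e (lo k) n <= ext f k < grid_hi e (hi k) n)%N.
  by move=> /familyP fQ kn; have := fQ (Ordinal kn); rewrite inE -extE.
have extn f k : f \in family Q -> (k < n)%N -> (n < ext f k)%N.
  by move=> fQ kn; have := extQ _ _ fQ kn; rewrite /grid_lo => /andP[]; lia.
have ext0 f k : f \in family Q -> (k < n)%N -> (0 < ext f k)%N.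
  by move=> fQ kn; exact: leq_ltn_trans (extn _ _ fQ kn).
have [N0 [mN0 PN0 regN0]] := ages_ae hxi.
pose s := [seq (h, f) | h <- histories n, f <- enum (family Q)].
(* Removing the null set of irregular paths lets the pathwise lemmas apply at every point of
   [F p]. *)
pose F (p : seq label * {ffun 'I_n -> 'I_N}) := pattern ages e p.1 (ext p.2) `\` N0.
have sP p : p \in s -> p.1 \in histories n /\ p.2 \in family Q.
  by case/allpairsP => -[h f] /= [? + ->]; rewrite mem_enum.
have mF p : p \in s -> measurable (F p).
  move=> /sP[hn fQ]; apply: measurableD => //.
  by apply: measurable_pattern hn _ => // k; exact: ext0.
have reg w : ~ N0 w -> (forall u k, 0 < xi u k w) /\
    (forall u, {homo (fun k => xi u k w) : j k / (j <= k)%N >-> j <= k}).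
  by move=> nw; apply: contrapT => nr; apply: nw; exact: regN0.
have first p w : p \in s -> F p w -> first_births ages p.1 w.
  move=> /sP[hn fQ] [pw /reg[w0 wle]].
  apply: (pattern_first_births e0 w0 wle hn _ pw); first by move=> k; exact: ext0.
  by move=> k; exact: extn.
exists (\big[setU/set0]_(p <- s) F p).
  split; first by rewrite big_seq; exact: bigsetU_measurable.
  move=> w; rewrite -bigcup_seq => -[p /= ps Fpw].
  have [hn fQ] := sP _ ps; have [pw /reg[w0 wle]] := Fpw.
  have fp := first _ _ ps Fpw.
  split=> //; split; first by exists p.1.
  move=> k kn; have := pattern_gap e0 w0 wle hn (fun k => @ext0 _ k fQ) pw kn.
  have b0 := birth_time_ge0 w0.
  have sh := size_history hn.
  rewrite -(nth_birthE b0 fp) ?sh// -(nth_birthE b0 fp) ?sh ?ltnS 1?ltnW//.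
  rewrite -/(interbirth _ _ _) => /andP[g1 g2].
  have /andP[q1 q2] := extQ _ _ fQ kn.
  rewrite (lt_le_trans (grid_lo_gap e0 (lo0 k) q1) g1)/=.
  exact: le_trans g2 (grid_hi_gap e0 (hi0 k) q2).
apply: (@le_trans _ _ (\sum_(p <- s) P (F p))%E); last first.
  apply: le_sum_measure => //.
  - apply: allpairs_uniq; rewrite ?uniq_histories ?enum_uniq//.
    by move=> [? ?] [? ?].
  - by rewrite big_seq; exact: bigsetU_measurable.
  - by move=> p ps w Fw; rewrite -bigcup_seq; exists p.
  move=> p q ps qs [w [Fp Fq]].
  have [hn fQ] := sP _ ps; have [hn' fQ'] := sP _ qs.
  have e12 : p.1 = q.1.
    apply: first_births_eq (first _ _ ps Fp) (first _ _ qs Fq) _.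
    by rewrite (size_history hn) (size_history hn').
  have [pw /reg[w0 wle]] := Fp; have [qw _] := Fq.
  (* Both patterns prescribe the same [grid_birth] values, so the partial sums of their gaps agree,
     and therefore the gaps. *)
  have sums j : (j <= n)%N -> (\sum_(k < j) ext p.2 k = \sum_(k < j) ext q.2 k)%N.
    move=> jn; have := pattern_grid_birth e0 w0 wle hn (fun k => @ext0 _ k fQ) pw jn.
    have := pattern_grid_birth e0 w0 wle hn' (fun k => @ext0 _ k fQ') qw jn.
    by rewrite -e12 => -> [].
  case: p q {ps qs Fp Fq pw qw} => [h f] [h' f'] /= in e12 sums hn fQ hn' fQ' *.
  rewrite e12; congr (_, _); apply/ffunP => i; apply: val_inj => /=.
  have := sums i.+1 (ltn_ord i); rewrite !big_ord_recr/= sums 1?ltnW//.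
  by move=> /addnI; rewrite !extE.
rewrite /s big_allpairs/=.
have PF h f : h \in histories n -> f \in family Q ->
    ((e ^+ n * expR (- (e * (\sum_(k < n) k.+1 * ext f k + n.+1 ^ 2)%N%:R)))%:E
    <= P (F (h, f)))%E.
  move=> hn fQ.
  have mp : measurable (pattern ages e h (ext f)).
    by apply: measurable_pattern hn _ => // k; exact: ext0.
  rewrite /F/= measureD//; last exact: le_lt_trans (probability_le1 _ mp) (ltry _).
  rewrite [X in (_ - X)%E](_ : _ = 0)%E ?sube0; last first.
    apply: (@subset_measure0 _ _ _ P _ N0) => //; first exact: measurableI.
  by apply: (pattern_probability hxi e01 hn) => k; exact: ext0.
apply: (@le_trans _ _ (\sum_(h <- histories n) \sum_(f in family Q)
    (e ^+ n * expR (- (e * (\sum_(k < n) k.+1 * ext f k + n.+1 ^ 2)%N%:R)))%:E)%E); last first.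
  rewrite [leLHS]big_seq [leRHS]big_seq; apply: lee_sum => h hn.
  rewrite big_enum /=; apply: lee_sum => f fQ; exact: PF.
under [leRHS]eq_bigr do rewrite sumEFin.
rewrite sumEFin lee_fin.
rewrite big_const_seq count_predT size_histories iter_addr addr0.
have -> : \sum_(f in family Q)
      e ^+ n * expR (- (e * (\sum_(k < n) k.+1 * ext f k + n.+1 ^ 2)%N%:R)) =
    expR (- (e * (n.+1 ^ 2)%N%:R)) * \prod_(i < n)
      \sum_(grid_lo e (lo i) n <= j < grid_hi e (hi i) n) e * expR (- (e * (i.+1%:R * j%:R))).
  transitivity (expR (- (e * (n.+1 ^ 2)%N%:R)) * \prod_(i < n)
      \sum_(j < N | Q i j) e * expR (- (e * (i.+1%:R * j%:R)))).
    rewrite bigA_distr_big_dep mulr_sumr; apply: eq_bigr => f fQ.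
    have -> : \prod_(i < n) (e * expR (- (e * (i.+1%:R * (f i)%:R)))) =
        e ^+ n * expR (- (e * (\sum_(k < n) k.+1 * ext f k)%N%:R)).
      rewrite big_split/= prodr_const card_ord; congr (_ * _).
      rewrite -expR_sum sumrN -mulr_sumr natr_sum.
      congr (expR (- (_ * _))); apply: eq_bigr => i _; by rewrite natrM extE.
    by rewrite natrD mulrDr opprD expRD mulrA mulrC.
  congr (_ * _); apply: eq_bigr => i _.
  have iN : (grid_hi e (hi i) n <= N)%N.
    exact: (@leq_bigmax _ (fun k : 'I_n => grid_hi e (hi k) n) i).
  rewrite [RHS](big_nat_widen _ _ _ _ _ iN) [RHS](@big_nat_widenl _ _ _ _ 0)// big_mkord.
  by apply: eq_bigl => j; rewrite /= andbC.
rewrite -[X in _ <= X]mulr_natl mulrCA ler_wpM2l ?expR_ge0//.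
(* The factorial is the number of histories; its factors cancel the denominators left by the
   geometric sums. *)
have -> : (n`!)%:R = \prod_(i < n) i.+1%:R :> R.
  by rewrite fact_prod natr_prod big_add1 big_mkord.
rewrite -big_split/=; apply: ler_prod => i _; rewrite le_max lexx/=.
rewrite [leRHS]mulrC -ler_pdivrMr ?ltr0n//.
exact: (geometric_lower_bound n e0 (ltr0Sn R i) (lo0 i) (hi0 i)).
Qed.

End gaps_lower_bound.

(** * From lower bounds on boxes to independence *)

Lemma measure_rays_unique (R : realType) (m1 m2 : {measure set R -> \bar R}) :
  (m1 setT < +oo)%E -> (forall x, m1 `]x, +oo[%classic = m2 `]x, +oo[%classic) ->
  forall A, measurable A -> m1 A = m2 A.
Proof.
move=> m1oo m12; apply: (measure_unique (@RGenOInfty.G R) (fun n => `](- n%:R), +oo[%classic)).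
- exact: RGenOInfty.measurableE.
- move=> _ _ [x ->] [y ->]; exists (Num.max x y).
  apply/seteqP; split=> z /=; rewrite !in_itv/= !andbT gt_max.
    by case=> -> ->.
  by move=> /andP.
- by move=> n; exists (- n%:R).
- rewrite -subTset => x _; exists (Num.truncn `|x|).+1 => //=.
  rewrite in_itv/= andbT ltrNl; apply: le_lt_trans (truncnS_gt _).
  by rewrite -normrN ler_norm.
- by move=> _ [x ->].
- by move=> n; apply: le_lt_trans m1oo; apply: le_measure; rewrite ?inE.
Qed.

(** This family contains the whole line and is closed under complement, which lets a lower bound on
    a box be compared with the lower bound on its complementary box. *)
Definition ray {R : realType} (A : set R) :=
  [\/ A = set0, A = setT, exists x, A = `]x, +oo[%classic
    | exists x, A = `]-oo, x]%classic].

Section independence_from_rays.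
Context {R : realType} {dT} {T : measurableType dT} (P : probability T R).
Variables (X : nat -> {RV P >-> R}) (nu : nat -> probability R R).

Let box n (A : nat -> set R) : set T := [set w | forall k, (k < n)%N -> A k (X k w)].

Hypothesis box_ge : forall n (A : nat -> set R), (forall k, ray (A k)) ->
  (\prod_(k < n) nu k (A k) <= P (box n A))%E.

Let measurable_ray (A : set R) : ray A -> measurable A.
Proof. by case=> [->|->|[x ->]|[x ->]]. Qed.

Let measurable_box n A : (forall k, (k < n)%N -> measurable (A k)) -> measurable (box n A).
Proof.
move=> mA; rewrite (_ : box n A = \bigcap_(k in `I_n) X k @^-1` A k).
  apply: bigcap_measurableType => k /= kn; rewrite -[_ @^-1` _]setTI.
  by apply: measurable_funP => //; exact: mA.
by apply/seteqP; split.
Qed.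

Let upd (A : nat -> set R) j B k := if k == j then B else A k.

Let box_upd n A j B : (j < n)%N -> box n (upd A j B) = box n (upd A j setT) `&` X j @^-1` B.
Proof.
move=> jn; apply/seteqP; split=> w /=.
  move=> H; split; last by have := H j jn; rewrite /upd eqxx.
  by move=> k kn; have := H k kn; rewrite /upd; case: ifP.
by case=> H Bj k kn; have := H k kn; rewrite /upd; case: eqP => // ->.
Qed.

Let prod_upd n A j B : (j < n)%N -> (\prod_(k < n) nu k (upd A j B k) =
  (\prod_(k < n | k != j :> nat) nu k (A k)) * nu j B)%E.
Proof.
move=> jn; rewrite (bigD1 (Ordinal jn))//= /upd eqxx muleC; congr (_ * _)%E.
by apply: eq_bigr => k /negPf; rewrite -val_eqE/= => ->.
Qed.

Let prod_upd_ge0 n A j : (0 <= \prod_(k < n | k != j :> nat) nu k (A k))%E.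
Proof. by apply: prode_ge0 => k _; exact: measure_ge0. Qed.

Let upd_id A j : upd A j (A j) = A.
Proof. by apply/funext => k; rewrite /upd; case: eqP => // ->. Qed.

Let rayC (A : set R) : ray A -> ray (~` A).
Proof.
case=> [->|->|[x ->]|[x ->]].
- by rewrite setC0; constructor 2.
- by rewrite setCT; constructor 1.
- by constructor 4; exists x; rewrite setCitvr.
- by constructor 3; exists x; rewrite setCitvl.
Qed.

Let box_ray n A : (forall k, ray (A k)) -> P (box n A) = (\prod_(k < n) nu k (A k))%E.
Proof.
move=> rA; apply/eqP; rewrite eq_le box_ge// andbT.
have mray A' : (forall k, ray (A' k)) -> measurable (box n A').
  by move=> rA'; apply: measurable_box => k _; exact: measurable_ray.
have finP A' : (forall k, ray (A' k)) -> P (box n A') \is a fin_num.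
  by move=> rA'; apply: fin_num_measure; exact: mray.
have finq A' : (forall k, ray (A' k)) -> (\prod_(k < n) nu k (A' k))%E \is a fin_num.
  move=> rA'; apply: prode_fin_num => k _; apply: fin_num_measure.
  exact: measurable_ray.
(* The defect [P (box n A) - prod] is nonnegative and additive in each
   coordinate, hence at most the defect of the full box, which is 0. *)
suff H j : (j <= n)%N -> forall A', (forall k, ray (A' k)) ->
    (forall k, (j <= k < n)%N -> A' k = setT) ->
    (P (box n A') <= \prod_(k < n) nu k (A' k))%E.
  by apply: (H n) => // k; lia.
elim: j => [_ A' rA' A'T|j IH jn A' rA' A'T].
  rewrite big1 => [|k _]; last by rewrite A'T ?leq0n ?ltn_ord// probability_setT.
  by apply: probability_le1; exact: mray.
have rU B : ray B -> forall k, ray (upd A' j B k) by move=> rB k; rewrite /upd; case: eqP.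
have rT : ray [set: R] by constructor 2.
have leT : (P (box n (upd A' j setT)) <= \prod_(k < n) nu k (upd A' j setT k))%E.
  apply: IH; rewrite 1?ltnW//; first exact: rU.
  move=> k /andP[jk kn]; rewrite /upd; case: eqVneq => // kj.
  by apply: A'T; rewrite kn andbT ltn_neqAle eq_sym kj.
have geC := box_ge n (rU _ (rayC (rA' j))).
have PE : (P (box n (upd A' j setT)) =
    P (box n A') + P (box n (upd A' j (~` A' j))))%E.
  have A'E : box n A' = box n (upd A' j setT) `&` X j @^-1` A' j.
    by rewrite -box_upd// upd_id.
  have -> : box n (upd A' j setT) = box n A' `|` box n (upd A' j (~` A' j)).
    rewrite A'E [X in _ `|` X]box_upd//.
    by rewrite -setIUr -preimage_setU setUv preimage_setT setIT.
  apply: measureU; [exact: mray|by apply: mray; apply: rU; exact: rayC|].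
  rewrite A'E [X in _ `&` X]box_upd//.
  by rewrite setIACA -preimage_setI setICr preimage_set0 setI0.
have qE : (\prod_(k < n) nu k (upd A' j setT k) =
    \prod_(k < n) nu k (A' k) + \prod_(k < n) nu k (upd A' j (~` A' j) k))%E.
  have -> : (\prod_(k < n) nu k (A' k) = \prod_(k < n) nu k (upd A' j (A' j) k))%E.
    by rewrite upd_id.
  have mAj := measurable_ray (rA' j).
  have nuC : (nu j (A' j) + nu j (~` A' j) = 1)%E.
    by rewrite (probability_setC _ mAj) addeC subeK// fin_num_measure.
  by rewrite !(prod_upd _ _ jn) probability_setT -nuC ge0_muleDr ?measure_ge0.
move: leT geC; rewrite PE qE.
have rC := rU _ (rayC (rA' j)).
rewrite -(fineK (finP _ rA')) -(fineK (finP _ rC)) -(fineK (finq _ rA')) -(fineK (finq _ rC)).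
by rewrite -!EFinD !lee_fin; lra.
Qed.

(** Rays are replaced by measurable sets one coordinate at a time: with the others fixed, both sides
    are finite measures of the [j]-th set, and they agree on open upper rays by induction. *)
Lemma box_eq n A : (forall k, measurable (A k)) ->
  P (box n A) = (\prod_(k < n) nu k (A k))%E.
Proof.
move=> mA; suff H j : (j <= n)%N -> forall A', (forall k, measurable (A' k)) ->
    (forall k, (j <= k)%N -> ray (A' k)) ->
    P (box n A') = (\prod_(k < n) nu k (A' k))%E.
  pose A' k := if (k < n)%N then A k else setT.
  have := H n (leqnn n) A'; rewrite (_ : box n A' = box n A); last first.
    by apply/seteqP; split=> w H' k kn; have := H' k kn; rewrite /A' kn.
  move=> ->.
  - by apply: eq_bigr => k _; rewrite /A' ltn_ord.
  - by move=> k; rewrite /A'; case: ifP.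
  - by move=> k; rewrite /A' leqNgt => /negPf ->; constructor 2.
elim: j => [_ A' mA' rA'|j IH jn A' mA' rA'].
  by apply: box_ray => k; exact: rA'.
have mS : measurable (box n (upd A' j setT)).
  by apply: measurable_box => k _; rewrite /upd; case: eqP.
(* The law of [X j] restricted to the box freed of its [j]-th constraint. *)
pose m1_of : {measure set R -> \bar R} := pushforward (mrestr P mS) (X j).
pose m1 := m1_of (measurable_funPT _).
have c0 : 0 <= fine (\prod_(k < n | k != j :> nat) nu k (A' k))%E.
  by rewrite fine_ge0// prod_upd_ge0.
pose m2 : {measure set R -> \bar R} := mscale (NngNum c0) (nu j).
have cfin : (\prod_(k < n | k != j :> nat) nu k (A' k))%E \is a fin_num.
  by apply: prode_fin_num => k _; exact: fin_num_measure.
rewrite -(upd_id A' j) (box_upd _ _ jn) (prod_upd _ _ jn).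
transitivity (m1 (A' j)); first by rewrite setIC.
transitivity (m2 (A' j)); last by rewrite /m2/= /mscale/= fineK.
apply: measure_rays_unique => //.
  rewrite /m1/= /pushforward /mrestr preimage_setT setTI.
  exact: le_lt_trans (probability_le1 _ mS) (ltry _).
move=> x; rewrite /m1 /m2/= /pushforward /mrestr /mscale/= fineK//.
rewrite setIC -box_upd// -prod_upd//; apply: IH; rewrite 1?ltnW//.
  by move=> k; rewrite /upd; case: eqP.
move=> k jk; rewrite /upd; case: eqVneq => kj; first by constructor 3; exists x.
by apply: rA'; rewrite ltn_neqAle eq_sym kj.
Qed.

Lemma law_of_box n A : measurable A -> distribution P (X n) A = nu n A.
Proof.
move=> mA; have := box_eq n.+1 (A := upd (fun=> setT) n A) _.
rewrite box_upd// (prod_upd _ _ (ltnSn n)) big1 => [|k _]; last exact: probability_setT.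
rewrite mul1e => <-.
  rewrite (_ : box _ _ = setT) ?setTI// -subTset => w _ k _.
  by rewrite /upd; case: ifP.
by move=> k; rewrite /upd; case: ifP.
Qed.

Lemma mutually_independent_of_box : mutually_independent P (fun n => X n : T -> R).
Proof.
move=> J A mA; have {mA} [B mB BA] : exists2 B : nat -> set R,
    (forall k, measurable (B k)) & forall k, k \in J -> A k = X k @^-1` B k.
  have B_ k : {B | measurable B & k \in J -> A k = X k @^-1` B}.
    have [/mA kJ|kJ] := boolP (k \in J); last by exists set0.
    by have [B mB <-] := cid2 kJ; exists B => // _; rewrite setTI.
  by exists (fun k => s2val (B_ k)) => k; [exact: (s2valP (B_ k))|exact: (s2valP' (B_ k))].
pose n := (\max_(k <- J) k).+1.
have Jn k : k \in J -> (k < n)%N by move=> kJ; rewrite ltnS; exact: leq_bigmax_seq.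
pose C k := if k \in J then B k else setT.
have mC k : measurable (C k) by rewrite /C; case: ifP.
have -> : \bigcap_(i in [set` J]) A i = box n C.
  apply/seteqP; split=> w /=.
    by move=> H k _; rewrite /C; case: ifP => // kJ; have := H k kJ; rewrite BA.
  by move=> H k kJ; have := H k (Jn k kJ); rewrite /C kJ BA.
rewrite box_eq//.
transitivity (\prod_(k <- J) nu k (B k))%E; last first.
  rewrite big_seq [RHS]big_seq; apply: eq_bigr => k kJ.
  by rewrite -law_of_box// BA.
rewrite -(big_mkord xpredT (fun k => nu k (C k))).
rewrite (bigID (mem J))/= [X in (_ * X)%E]big1 ?mule1; last first.
  by move=> k /negPf kJ; rewrite /C kJ probability_setT.
rewrite -big_filter; under eq_big_seq => k.
  by rewrite mem_filter => /andP[kJ _]; rewrite /C kJ; over.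
apply: perm_big; apply: uniq_perm; rewrite ?filter_uniq ?iota_uniq ?fset_uniq//.
move=> k; rewrite mem_filter mem_index_iota/=.
by apply: andb_idr => /Jn.
Qed.

End independence_from_rays.

(** * Law of the times between births *)

(* [exponential_prob] is a measure for the display of the generated Borel
   sigma-algebra, not for the default one, which random variables use. *)
Definition exponential_law {R : realType} {r : R} (r0 : 0 < r) (A : set R) : \bar R :=
  exponential_prob r A.

Section exponential_law.
Context {R : realType} (r : R) (r0 : 0 < r).

Let m := ltac:(pose m_of := (exponential_prob r : probability _ R); exact (m_of r0)).

Let law0 : exponential_law r0 set0 = 0%E.
Proof. exact: (measure0 m). Qed.

Let law_ge0 A : (0 <= exponential_law r0 A)%E.
Proof. exact: (measure_ge0 m). Qed.

Let law_sigma_additive : semi_sigma_additive (exponential_law r0).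
Proof. by move=> F mF tF mUF; exact: (@measure_semi_sigma_additive _ _ _ m). Qed.

HB.instance Definition _ := isMeasure.Build _ _ _
  (exponential_law r0) law0 law_ge0 law_sigma_additive.

Let law_setT : exponential_law r0 [set: R] = 1%E.
Proof. exact: (@probability_setT _ _ _ m). Qed.

HB.instance Definition _ :=
  @Measure_isProbability.Build _ _ R (exponential_law r0) law_setT.

Lemma exponential_law_lt0 : exponential_law r0 `]-oo, 0[%classic = 0%E.
Proof.
by apply: integral0_eq => x /=; rewrite in_itv/= => x0; rewrite lt0_exponential_pdf.
Qed.

Lemma exponential_law_Nyc x :
  exponential_law r0 `]-oo, x]%classic = (1 - expR (- (r * Num.max 0 x)))%:E.
Proof.
have [x0|x0] := leP 0 x; last first.
  rewrite mulr0 oppr0 expR0 subrr.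
  apply: (subset_measure0 _ _ _ exponential_law_lt0) => //.
  by move=> y /=; rewrite !in_itv/= => /le_lt_trans; apply.
have split0 : `]-oo, x]%classic = `]-oo, 0[ `|` `[0, x] :> set R.
  apply/seteqP; split=> y /=; rewrite !in_itv/=.
    by move=> yx; have [|] := ltP y 0; [left|right; rewrite yx].
  by case=> [/ltW/le_trans->|/andP[]].
rewrite split0.
transitivity (exponential_law r0 `]-oo, 0%R[%classic + exponential_law r0 `[0%R, x]%classic)%E.
  apply: measureU => //.
  by rewrite -subset0 => y []/=; rewrite !in_itv/= => y0 /andP[]; rewrite leNgt y0.
rewrite exponential_law_lt0 add0e.
move: x0; rewrite le_eqVlt => /predU1P[<-|x0].
  rewrite set_itv1 mulr0 oppr0 expR0 subrr.
  exact: integral_set1.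
by rewrite /exponential_law exponential_prob_itv0c// mulNr.
Qed.

Lemma exponential_law_oy x :
  exponential_law r0 `]x, +oo[%classic = (expR (- (r * Num.max 0 x)))%:E.
Proof.
transitivity (1 - exponential_law r0 `]-oo, x]%classic)%E.
  by rewrite -setCitvl; exact: probability_setC.
rewrite exponential_law_Nyc -EFinB.
by rewrite opprB addrC subrK.
Qed.

End exponential_law.

(** * Limits of the bounds along the meshes [harmonic j] *)

Lemma cvg_prod_ord (R : realType) n (f : nat -> nat -> R) (l : nat -> R) :
  (forall k, f k @ \oo --> l k) ->
  (fun j => \prod_(k < n) f k j) @ \oo --> \prod_(k < n) l k.
Proof.
move=> fl; elim: n => [|n IH].
  by rewrite big_ord0; under eq_fun do rewrite big_ord0; exact: cvg_cst.
by rewrite big_ord_recr/=; under eq_fun do rewrite big_ord_recr/=; exact: cvgM.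
Qed.

Lemma cvg_max0 (R : realType) (f : nat -> R) (l : R) : 0 <= l ->
  f @ \oo --> l -> (fun j => Num.max 0 (f j)) @ \oo --> l.
Proof.
move=> l0 fl; have -> : l = (0 + l + `|0 - l|) / 2.
  by rewrite sub0r normrN ger0_norm//; lra.
under eq_fun do rewrite maxr_absE.
apply: cvgMl; apply: cvgD; first by apply: cvgD => //; exact: cvg_cst.
by apply: cvg_norm; apply: cvgB => //; exact: cvg_cst.
Qed.

Lemma cvg_expRN_affine (R : realType) (r y c : R) :
  (fun j => expR (- (r * (y + harmonic j * c)))) @ \oo --> expR (- (r * y)).
Proof.
apply: continuous_cvg; first exact: continuous_expR.
apply: cvgN; apply: cvgMr; rewrite -[X in _ --> X]addr0 -[X in _ --> _ + X](mul0r c).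
apply: cvgD; first exact: cvg_cst.
by apply: cvgMl; exact: cvg_harmonic.
Qed.

(** Here [j + n] stands for an infinite upper end. As [harmonic j * n%:R] is at most [n], the
    exponent is at least [j] in size, and exp(- j) <= 1 / (j + 1). *)
Lemma cvg_expRN_shift (R : realType) (k n : nat) :
  (fun j => expR (- (k.+1%:R * ((j + n)%:R - harmonic j * n%:R)))) @ \oo --> (0 : R).
Proof.
have bound j : expR (- (k.+1%:R * ((j + n)%:R - harmonic j * n%:R))) <= harmonic j :> R.
  have a1 : harmonic j <= 1 :> R by rewrite invf_le1// ler1n.
  rewrite -[leRHS]/(j.+1%:R^-1); move: (harmonic j) a1 => a a1.
  rewrite expRN lef_pV2 ?posrE ?expR_gt0//.
  apply: le_trans (expR_ge1Dx _); rewrite -natr1 addrC lerD2l.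
  have an : a * n%:R <= n%:R by rewrite ler_piMl.
  apply: (@le_trans _ _ ((j + n)%:R - a * n%:R)).
    by rewrite natrD -addrA lerDl subr_ge0.
  by rewrite ler_peMl ?ler1n// natrD subr_ge0 (le_trans an)// lerDr.
apply: (@squeeze_cvgr _ _ _ _ (fun=> 0) harmonic).
- by near=> j; rewrite expR_ge0 bound.
- exact: cvg_cst.
- exact: cvg_harmonic.
Unshelve. all: by end_near. Qed.

Section interbirth_law.
Context {R : realType} {dT} {T : measurableType dT} (P : probability T R).
Variable xi : label -> nat -> {RV P >-> R}.
Hypothesis hxi : cmj_process 1 xi.

Let ages u k : T -> R := xi u k.

Definition yule_law (k : nat) : probability R R := exponential_law (ltr0Sn R k).

(** Each ray is exhausted by intervals of nonnegative numbers. Unbounded rays get the upper end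
    [j + n], growing as the mesh shrinks; the negative part, which the exponential law does not
    charge, is dropped; the empty set gets an empty interval. *)
Let ray_bounds (I : set R) (k n : nat) : ray I ->
  exists p : R * (nat -> R), [/\ 0 <= p.1, forall j, 0 <= p.2 j,
    forall j y, p.1 < y <= p.2 j -> I y &
    (fun j => Num.max 0 (expR (- (k.+1%:R * (p.1 + harmonic j * n.+1%:R)))
                       - expR (- (k.+1%:R * (p.2 j - harmonic j * n%:R))))) @ \oo
      --> fine (yule_law k I)].
Proof.
have lim_lo lo := @cvg_expRN_affine R k.+1%:R lo n.+1%:R.
have lim_hi (hi : R) : (fun j => expR (- (k.+1%:R * (hi - harmonic j * n%:R)))) @ \oo -->
    expR (- (k.+1%:R * hi)).
  have := @cvg_expRN_affine R k.+1%:R hi (- n%:R).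
  by under eq_fun => j do rewrite (mulrN (harmonic j)).
have lim_oo := @cvg_expRN_shift R k n.
have := lim_lo 0; rewrite mulr0 oppr0 expR0 => lim_lo0.
have max0 x : 0 <= Num.max 0 x :> R by rewrite le_max lexx.
case=> [->|->|[x ->]|[x ->]].
- exists (0, fun=> 0); split=> //= [_ y /andP[/lt_le_trans h /h]|].
    by rewrite ltxx.
  rewrite measure0; apply: cvg_max0 => //.
  by rewrite -[X in _ --> X](subrr (expR (- (k.+1%:R * 0)))); exact: cvgB (lim_lo 0) (lim_hi 0).
- exists (0, fun j => (j + n)%:R); split=> //=.
  rewrite probability_setT; apply: cvg_max0 => //.
  by rewrite -[X in _ --> X]subr0; exact: cvgB lim_lo0 lim_oo.
- exists (Num.max 0 x, fun j => (j + n)%:R); split=> //=.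
    by move=> j y /andP[]; rewrite gt_max in_itv/= andbT => /andP[].
  rewrite exponential_law_oy/=; apply: cvg_max0; first exact: expR_ge0.
  by rewrite -[X in _ --> X]subr0; exact: cvgB (lim_lo _) lim_oo.
- exists (0, fun=> Num.max 0 x); split=> //=.
    by move=> _ y; rewrite in_itv/= le_max => /andP[y0]; rewrite leNgt y0.
  rewrite exponential_law_Nyc/=; apply: cvg_max0.
    by rewrite subr_ge0 -[leRHS]expR0 ler_expR oppr_le0 mulr_ge0.
  exact: cvgB lim_lo0 (lim_hi _).
Qed.

Lemma interbirth_box n (I : nat -> set R) : (forall k, ray (I k)) ->
  exists (U : nat -> set T) (c : nat -> R),
   [/\ forall j, measurable (U j),
       forall j w, U j w -> [/\ forall u k, 0 < xi u k w,
         exists2 h, h \in histories n & first_births ages h w &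
         forall k, (k < n)%N -> I k (interbirth xi k w)],
       forall j, ((c j)%:E <= P (U j))%E &
       c @ \oo --> \prod_(k < n) fine (yule_law k (I k))].
Proof.
move=> rI; have [p /all_and4[lo0 hi0 inI lim]] := choice (fun k => ray_bounds k n (rI k)).
have e01 j : 0 < (harmonic j : R) <= 1.
  by rewrite invr_gt0 ltr0n/= invf_le1// ler1n.
have H j : {U | measurable U /\
    (forall w, U w -> (forall u k, 0 < xi u k w) /\
       (exists2 h, h \in histories n & first_births ages h w) /\
       forall k, (k < n)%N -> (p k).1 < interbirth xi k w <= (p k).2 j) &
    ((expR (- (harmonic j * (n.+1 ^ 2)%N%:R)) *
      \prod_(k < n) Num.max 0 (expR (- (k.+1%:R * ((p k).1 + harmonic j * n.+1%:R)))
                    - expR (- (k.+1%:R * ((p k).2 j - harmonic j * n%:R)))))%:E <= P U)%E}.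
  apply: cid2; exact: (gaps_lower_bound hxi n (e01 j) lo0 (fun k => hi0 k j)).
exists (fun j => s2val (H j)); eexists; split.
- by move=> j; have [] := s2valP (H j).
- move=> j w Uw; have [_ /(_ w Uw)[w0 [hh hI]]] := s2valP (H j); split=> //.
  by move=> k kn; exact/inI/hI.
- by move=> j; exact: (s2valP' (H j)).
- rewrite -[X in _ --> X]mul1r; apply: cvgM; last first.
    exact: (@cvg_prod_ord R n (fun k j => Num.max 0
      (expR (- (k.+1%:R * ((p k).1 + harmonic j * n.+1%:R))) -
       expR (- (k.+1%:R * ((p k).2 j - harmonic j * n%:R))))) _ lim).
  have := @cvg_expRN_affine R 1 0 (n.+1 ^ 2)%N%:R; rewrite mulr0 oppr0 expR0.
  by under eq_fun do rewrite mul1r add0r.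
Qed.

(** With no constraint on the gaps the lower bounds tend to 1, so the events [U j], on which a
    history exists, have a union of full probability. *)
Lemma histories_ae : {ae P, forall w, (forall u k, 0 < xi u k w) /\
  forall n, exists2 h, h \in histories n & first_births ages h w}.
Proof.
have hist n : \forall w \ae P, (forall u k, 0 < xi u k w) /\
    exists2 h, h \in histories n & first_births ages h w.
  have [U [c [mU HU cU c1]]] := @interbirth_box n (fun=> setT) (fun _ => Or42 _ _ _ erefl).
  have {}c1 : c @ \oo --> (1 : R).
    by move: c1; rewrite big1// => k _; rewrite probability_setT.
  exists (\bigcap_j ~` U j); split.
  - by apply: bigcap_measurableType => j _; exact: measurableC.
  - apply/eqP; rewrite eq_le measure_ge0 andbT.
    have le_c j : (P (\bigcap_j ~` U j) <= (1 - c j)%:E)%E.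
      apply: (@le_trans _ _ (P (~` U j))).
        apply: le_measure; rewrite ?inE; last exact: bigcap_inf.
          by apply: bigcap_measurableType => i _; exact: measurableC.
        exact: measurableC.
      by rewrite probability_setC// EFinB leeB.
    have mcap : measurable (\bigcap_j ~` U j).
      by apply: bigcap_measurableType => j _; exact: measurableC.
    rewrite -(fineK (fin_num_measure P _ mcap)) lee_fin.
    have c0 : (fun j => 1 - c j) @ \oo --> (0 : R).
      by rewrite -[X in _ --> X](subrr (1 : R)); exact: cvgB (cvg_cst _) c1.
    by apply: (cvgr_to_ge c0); near=> j; rewrite -lee_fin fineK ?fin_num_measure.
  - move=> w /= nw j _ Ujw; apply: nw.
    by have [] := HU _ _ Ujw.
have := ae_foralln hist; apply: filterS => w H; split; first by case: (H 0%N).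
by move=> n; case: (H n).
Unshelve. all: by end_near. Qed.

Let interbirth_box_ge n (I : nat -> set R) : (forall k, ray (I k)) ->
  (\prod_(k < n) yule_law k (I k) <=
   P [set w | forall k, (k < n)%N -> I k (interbirth xi k w)])%E.
Proof.
move=> rI; have [U [c [mU HU cU c1]]] := interbirth_box n rI.
have mI : measurable [set w | forall k, (k < n)%N -> I k (interbirth xi k w)].
  rewrite (_ : [set _ | _] = \bigcap_(k in `I_n) interbirth xi k @^-1` I k).
    apply: bigcap_measurableType => k _; rewrite -[_ @^-1` _]setTI.
    apply: measurable_funP => //.
    by case: (rI k) => [->|->|[x ->]|[x ->]].
  by apply/seteqP; split.
have -> : (\prod_(k < n) yule_law k (I k) = (\prod_(k < n) fine (yule_law k (I k)))%:E)%E.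
  rewrite -prodEFin; apply: eq_bigr => k _; rewrite fineK// fin_num_measure//.
  by case: (rI k) => [->|->|[x ->]|[x ->]].
rewrite -(fineK (fin_num_measure P _ mI)) lee_fin.
apply: (cvgr_to_le c1); near=> j; rewrite -lee_fin fineK ?fin_num_measure//.
apply: le_trans (cU j) _; apply: le_measure; rewrite ?inE//.
by move=> w /HU[].
Unshelve. all: by end_near. Qed.

Lemma interbirth_boxE n (A : nat -> set R) : (forall k, measurable (A k)) ->
  P [set w | forall k, (k < n)%N -> A k (interbirth xi k w)] =
  (\prod_(k < n) yule_law k (A k))%E.
Proof. exact: (box_eq interbirth_box_ge). Qed.

Lemma interbirth_law n A : measurable A ->
  distribution P (interbirth xi n : {RV P >-> R}) A = exponential_prob n.+1%:R A.
Proof.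
move=> mA; exact: (law_of_box interbirth_box_ge).
Qed.

Lemma interbirth_independent :
  mutually_independent P (fun n => interbirth xi n : T -> R).
Proof. exact: (mutually_independent_of_box interbirth_box_ge). Qed.

End interbirth_law.

(** * The Yule process *)

Lemma card_eq_seq (T : choiceType) (s : seq T) : uniq s -> ([set` s] #= `I_(size s))%card.
Proof.
move=> us; rewrite (_ : [set` s] = [set` [fset x in s]%fset]); last first.
  by apply/seteqP; split=> x /=; rewrite inE.
by apply/card_eq_fsetP; rewrite card_fseq undup_id.
Qed.

Section yule.
Context {R : realType} {dT} {T : measurableType dT} (P : probability T R).
Variable xi : label -> nat -> {RV P >-> R}.

Let ages u k : T -> R := xi u k.
Let b u w : R := birth_time ages u w.

Section pointwise.
Variable w : T.
Hypotheses (xi0 : forall u k, 0 < xi u k w)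
  (hist : forall n, exists2 h, h \in histories n & first_births ages h w).

Let b0 := birth_time_ge0 xi0.

Lemma nth_birth0 : nth_birth xi 0 w = 0.
Proof.
have [h hn fh] := hist 0.
by rewrite (nth_birthE b0 fh) ?(size_history hn)// (nth_history0 hn).
Qed.

Lemma nth_birth_lt m n : (m < n)%N -> nth_birth xi m w < nth_birth xi n w.
Proof.
move=> mn; have [h hn fh] := hist n; have sh := size_history hn.
rewrite !(nth_birthE b0 fh) ?sh// 1?ltnS 1?ltnW//.
apply: (sorted_ltn_nth _ [::] fh.1) => //; rewrite ?inE ?sh// 1?ltnS 1?ltnW//.
by move=> u v v'; exact: lt_trans.
Qed.

Lemma nth_birth_le m n : (m <= n)%N -> nth_birth xi m w <= nth_birth xi n w.
Proof.
by rewrite leq_eqVlt => /predU1P[->//|mn]; exact/ltW/nth_birth_lt.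
Qed.

Lemma sum_interbirth n : \sum_(k < n) interbirth xi k w = nth_birth xi n w.
Proof.
rewrite -(big_mkord xpredT (fun k => interbirth xi k w)) telescope_sumr//.
by rewrite nth_birth0 subr0.
Qed.

Lemma cmj_sizeE t : 0 <= t -> cmj_size ages t w =
  (1 + counting [set n | (\sum_(k < n.+1) interbirth xi k w <= t)%R])%E.
Proof.
move=> t0; under eq_set do rewrite sum_interbirth.
(* Explosion is not excluded for a given outcome: if all births occur by time [t], both sides are
   infinite. *)
have [[n tn]|nN] := pselect (exists n, t < nth_birth xi n w); last first.
  have le_t n : nth_birth xi n w <= t.
    by rewrite leNgt; apply/negP => tn; apply: nN; exists n.
  rewrite (_ : [set n | _] = setT); last by apply/seteqP; split=> // n _ /=.
  rewrite counting_infinite; last exact: infinite_nat.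
  rewrite addey// /cmj_size counting_infinite// => -[m Um].
  have [h hm fh] := hist m; have sh := size_history hm.
  have sub : [set` h] `<=` [set u | b u w <= t].
    move=> u /= uh; apply: le_trans (le_t (index u h)).
    by rewrite (nth_birthE b0 fh) ?nth_index// index_mem.
  have := subset_card_le sub; rewrite (card_le_eqr Um).
  rewrite (card_le_eql (card_eq_seq (uniq_history hm))) card_le_II sh.
  by rewrite ltnn.
(* [N] is the first birth after [t]; with the root numbered 0, the population is [N] and [N.-1]
   births follow that of the root. *)
have [N tN Nmin] : exists2 N, t < nth_birth xi N w &
    forall k, (k < N)%N -> nth_birth xi k w <= t.
  have ex : exists n, t < nth_birth xi n w by exists n.
  exists (ex_minn ex); case: ex_minnP => // m tm mmin k km.
  by rewrite leNgt; apply/negP => /mmin; rewrite leqNgt km.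
have N0 : (0 < N)%N.
  by rewrite lt0n; apply/eqP => N0; move: tN; rewrite N0 nth_birth0 ltNge t0.
have [h hN fh] := hist N; have sh := size_history hN.
have bE k : (k <= N)%N -> b (nth [::] h k) w = nth_birth xi k w.
  by move=> kN; rewrite (nth_birthE b0 fh) ?sh.
have -> : [set n | (nth_birth xi n.+1 w <= t)%R] = `I_N.-1.
  apply/seteqP; split=> k /=.
    rewrite -ltnS prednK// => kt; rewrite ltnNge; apply/negP => /nth_birth_le.
    by move=> /(lt_le_trans tN) /lt_le_trans /(_ kt); rewrite ltxx.
  by rewrite -ltnS prednK// => /Nmin.
have -> : cmj_size ages t w = N%:R%:E.
  rewrite /cmj_size (_ : [set u | _] = [set` take N h]).
    apply: counting_card_eq; have := card_eq_seq (take_uniq N (uniq_history hN)).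
    by rewrite size_takel// sh.
  apply/seteqP; split=> u /=.
    move=> ut; have uh : u \in h.
      apply: contraTT isT => uh; have := fh.2 _ _ (mem_nth [::] (_ : N < size h)%N) uh.
      rewrite sh => /(_ (ltnSn _)); rewrite -/(b _ _) bE//.
      by move=> /(lt_trans tN) /lt_le_trans /(_ ut); rewrite ltxx.
    rewrite in_take// ltnNge; apply/negP => /nth_birth_le.
    rewrite -(bE (index u h)); last by rewrite -ltnS -sh index_mem.
    rewrite nth_index// => /(lt_le_trans tN) /lt_le_trans /(_ ut).
    by rewrite ltxx.
  move=> ut; have uh := mem_take ut.
  rewrite -/(b u w) -(nth_index [::] uh) bE.
    by apply: Nmin; rewrite -in_take.
  by rewrite -ltnS -sh index_mem.
rewrite (counting_card_eq (card_eqxx _)).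
by rewrite -[in LHS](prednK N0) -natr1 EFinD addeC.
Qed.

End pointwise.

Lemma cmj_size_yule : cmj_process 1 xi -> yule_process P 1 (cmj_size ages).
Proof.
move=> hxi; exists (fun n => interbirth xi n : {RV P >-> R}); split.
- by move=> n A mA; rewrite (interbirth_law hxi)// mul1r.
- exact: interbirth_independent.
- have := histories_ae hxi; apply: filterS => w [w0 hist] t t0.
  exact: cmj_sizeE.
Qed.

End yule.

(** * Sums of independent exponentials *)

(** The derivative of (a - c)^(n+1) with respect to a^(n+1) is (1 - c/a)^n, increasing in [a]. The
    proof compares the factorisations of both differences of powers term by term. *)
Lemma power_sandwich (R : realType) n (a a' c : R) : 0 < a' -> a' <= a ->
  0 <= c -> c <= a' ->
  (1 - c / a') ^+ n * (a ^+ n.+1 - a' ^+ n.+1) <= (a - c) ^+ n.+1 - (a' - c) ^+ n.+1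
    <= (1 - c / a) ^+ n * (a ^+ n.+1 - a' ^+ n.+1).
Proof.
move=> a'0 a'a c0 ca'; have a0 : 0 < a by exact: lt_le_trans a'a.
have q'0 : 0 <= 1 - c / a' by rewrite subr_ge0 ler_pdivrMr// mul1r.
have q'q : 1 - c / a' <= 1 - c / a.
  by rewrite lerD2l lerN2; apply: ler_wpM2l => //; rewrite lef_pV2.
have q0 : 0 <= 1 - c / a by exact: le_trans q'q.
have aE x : 0 < x -> x - c = x * (1 - c / x).
  by move=> x0; rewrite mulrBr mulr1 mulrCA divff ?gt_eqF// mulr1.
rewrite !subrXX (_ : a - c - (a' - c) = a - a'); last by ring.
rewrite !(mulrCA _ (a - a')) !(aE a)// !(aE a')//=.
have aa' : 0 <= a - a' by rewrite subr_ge0.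
have term (i : 'I_n.+1) : 0 <= a ^+ (n - i) * a' ^+ i.
  by rewrite mulr_ge0// exprn_ge0// ltW.
have split_term (i : 'I_n.+1) : (a * (1 - c / a)) ^+ (n - i) * (a' * (1 - c / a')) ^+ i =
    (1 - c / a) ^+ (n - i) * (1 - c / a') ^+ i * (a ^+ (n - i) * a' ^+ i).
  by rewrite !exprMn; ring.
have ni (x : R) (i : 'I_n.+1) : x ^+ n = x ^+ (n - i) * x ^+ i.
  by rewrite -exprD subnK// -ltnS.
apply/andP; split; apply: ler_wpM2l => //; rewrite mulr_sumr; apply: ler_sum => i _;
  rewrite split_term; apply: ler_wpM2r => //.
- rewrite (ni (1 - c / a') i); apply: ler_wpM2r; first exact: exprn_ge0.
  by rewrite lerXn2r.
- rewrite [leRHS](ni _ i); apply: ler_wpM2l; first exact: exprn_ge0.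
  by rewrite lerXn2r.
Qed.

(** The case a = exp(- y), c = exp(- t) of [power_sandwich]. It replaces the fact that - (exp(- y) -
    exp(- t))^(n+1) is an antiderivative in [y] of the convolution integrand. *)
Lemma expR_sandwich (R : realType) n (t y y' : R) : y <= y' -> y' <= t ->
  let p := expR (- (n.+1%:R * y)) - expR (- (n.+1%:R * y')) in
  (1 - expR (- (t - y'))) ^+ n * p <=
  (expR (- y) - expR (- t)) ^+ n.+1 - (expR (- y') - expR (- t)) ^+ n.+1 <=
  (1 - expR (- (t - y))) ^+ n * p.
Proof.
move=> yy' y't /=.
have E z : expR (- (n.+1%:R * z)) = expR (- z) ^+ n.+1 by rewrite -mulrN expRM_natl.
have D z : expR (- (t - z)) = expR (- t) / expR (- z).
  by rewrite opprB addrC expRD (expRN z) invrK.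
rewrite !E !D; apply: power_sandwich; rewrite ?expR_gt0 ?expR_ge0//.
  by rewrite ler_expR lerN2.
by rewrite ler_expR lerN2.
Qed.

Lemma exponential_law_cell (R : realType) (r e : R) (r0 : 0 < r) k : 0 < e ->
  exponential_law r0 (cell e k) =
  (expR (- (r * (k%:R * e))) - expR (- (r * (k.+1%:R * e))))%:E.
Proof.
move=> e0; have lee : k%:R * e <= k.+1%:R * e by rewrite ler_pM2r// ler_nat.
pose beyond j : set R := `]j%:R * e, +oo[%classic.
have cellE : beyond k = cell e k `|` beyond k.+1.
  apply/seteqP; split=> x /=; rewrite /beyond /cell/= !in_itv/= ?andbT.
    by move=> kx; have [xk|] := leP x (k.+1%:R * e); [left; rewrite kx|right].
  by case=> [/andP[]//|/(le_lt_trans lee)].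
have ke0 j : 0 <= j%:R * e by rewrite mulr_ge0// ltW.
have : exponential_law r0 (beyond k) =
    (exponential_law r0 (cell e k) + exponential_law r0 (beyond k.+1))%E.
  rewrite cellE; apply: measureU; rewrite /beyond /cell//.
  rewrite -subset0 => x [/=]; rewrite !in_itv/= andbT => /andP[_].
  by rewrite leNgt => /negP.
rewrite /beyond !exponential_law_oy !max_r// => H.
have cfin : exponential_law r0 (cell e k) \is a fin_num.
  by apply: (fin_num_measure (exponential_law r0)); rewrite /cell.
by move: H; rewrite -(fineK cfin) -EFinD => -[->]; congr EFin; ring.
Qed.

Section riemann_sandwich.
Context {R : realType}.
Variables (n M : nat) (t : R).
Hypothesis t0 : 0 < t.

Let e := t / M.+1%:R.
Let p k : R := expR (- (n.+1%:R * (k%:R * e))) - expR (- (n.+1%:R * (k.+1%:R * e))).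
Let F s : R := (1 - expR (- s)) ^+ n.

Let e0 : 0 < e. Proof. by rewrite divr_gt0. Qed.

Let Me : M.+1%:R * e = t.
Proof. by rewrite mulrC divfK// pnatr_eq0. Qed.

Let le_grid_points j k : (j <= k)%N -> j%:R * e <= k%:R * e.
Proof. by move=> jk; rewrite ler_pM2r// ler_nat. Qed.

(* The outer sums discretise the convolution of [F] with the exponential law of
   rate [n.+1]; by [expR_sandwich] the middle term telescopes between them. *)
Lemma riemann_sandwich :
  \sum_(k < M.+1) F (t - k.+1%:R * e) * p k <= (1 - expR (- t)) ^+ n.+1
    <= \sum_(k < M.+1) F (t - k%:R * e) * p k.
Proof.
pose H k : R := (expR (- (k%:R * e)) - expR (- t)) ^+ n.+1.
have -> : (1 - expR (- t)) ^+ n.+1 = \sum_(k < M.+1) (H k - H k.+1).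
  rewrite -(big_mkord xpredT (fun k => H k - H k.+1)).
  under eq_bigr do rewrite -opprB; rewrite sumrN telescope_sumr// opprB.
  have e00 : 0%:R * e = 0 by exact: mul0r.
  by rewrite /H Me e00 oppr0 expR0 subrr (exprS 0) mul0r subr0.
have sandwich (k : 'I_M.+1) := @expR_sandwich R n t _ _
  (le_grid_points (leqnSn k)) (etrans (congr1 _ (esym Me)) (le_grid_points (ltn_ord k))).
by apply/andP; split; apply: ler_sum => k _; have /andP[] := sandwich k.
Qed.

(** Each weight [p k] is at most [n.+1%:R * e], and the increments of the monotone function [F],
    with values in [0, 1], telescope to at most 1. *)
Lemma riemann_gap :
  \sum_(k < M.+1) F (t - k%:R * e) * p k - \sum_(k < M.+1) F (t - k.+1%:R * e) * p k
    <= n.+1%:R * e.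
Proof.
have F01 s : 0 <= s -> 0 <= F s <= 1.
  move=> s0; have e1 : expR (- s) <= 1 by rewrite -[leRHS]expR0 ler_expR oppr_le0.
  rewrite /F exprn_ge0 ?subr_ge0//=; apply: exprn_ile1; first by rewrite subr_ge0.
  by rewrite gerBl expR_ge0.
have tk (k : nat) : (k <= M.+1)%N -> 0 <= t - k%:R * e.
  by move=> kM; rewrite subr_ge0 -[leRHS]Me; exact: le_grid_points.
have p_le k : p k <= n.+1%:R * e.
  rewrite /p -[k.+1%:R]natr1 mulrDl mul1r mulrDr opprD expRD.
  set a := expR (- (n.+1%:R * (k%:R * e))).
  have a0 : 0 <= a by exact: expR_ge0.
  have a1 : a <= 1.
    by rewrite -[leRHS]expR0 ler_expR oppr_le0 mulr_ge0// mulr_ge0// ltW.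
  have := expR_ge1Dx (- (n.+1%:R * e)).
  have : 0 <= n.+1%:R * e by rewrite mulr_ge0// ltW.
  move: (n.+1%:R * e) (expR (- (n.+1%:R * e))) a a0 a1 => x y a a0 a1 x0 xy.
  nra.
rewrite -sumrB; apply: (@le_trans _ _ (\sum_(k < M.+1)
    (n.+1%:R * e) * (F (t - k%:R * e) - F (t - k.+1%:R * e)))).
  apply: ler_sum => k _; rewrite -mulrBl mulrC ler_wpM2r// subr_ge0 /F.
  have /andP[_ h1] := F01 _ (tk k.+1 (ltn_ord k)).
  have kk := le_grid_points (leqnSn k).
  have tk1 := tk k.+1 (ltn_ord k).
  apply: lerXn2r; rewrite ?nnegrE ?subr_ge0.
  - by rewrite -[leRHS]expR0 ler_expR oppr_le0.
  - by rewrite -[leRHS]expR0 ler_expR oppr_le0; apply: le_trans tk1 _; rewrite lerD2l lerN2.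
  - by rewrite lerD2l lerN2 ler_expR lerN2 lerD2l lerN2.
rewrite -mulr_sumr -(big_mkord xpredT (fun k => F (t - k%:R * e) - F (t - k.+1%:R * e))).
under eq_bigr do rewrite -opprB.
rewrite sumrN (telescope_sumr (fun k => F (t - k%:R * e)))// opprB.
rewrite -[leRHS]mulr1 ler_wpM2l ?(mulr_ge0 _ (ltW e0))//.
have /andP[_ h1] := F01 _ (tk 0%N isT); have /andP[h0 _] := F01 _ (tk M.+1 (leqnn _)).
by rewrite lerBlDr (le_trans h1)// lerDl.
Qed.

End riemann_sandwich.

Section sum_of_exponentials.
Context {R : realType} {dT} {T : measurableType dT} (P : probability T R).
Variable X : nat -> {RV P >-> R}.
Hypothesis boxX : forall n (A : nat -> set R), (forall k, measurable (A k)) ->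
  P [set w | forall k, (k < n)%N -> A k (X k w)] = (\prod_(k < n) yule_law k (A k))%E.

Let S n w : R := \sum_(k < n) X k w.

Let measurable_S n : measurable_fun setT (S n).
Proof.
by rewrite /S; apply: measurable_sum => k; exact: measurable_funPT.
Qed.

Let positive_X : P.-negligible (\bigcup_k [set w | X k w <= 0]).
Proof.
apply: negligible_bigcup => k; exists [set w | X k w <= 0]; split=> //.
  by rewrite -[X in measurable X]setTI; exact: measurable_fun_le.
have := boxX k.+1 (A := fun j => if j == k then `]-oo, 0%R]%classic else setT).
rewrite (_ : [set w | _] = [set w | X k w <= 0]); last first.
  apply/seteqP; split=> w /=.
    by move=> /(_ k (ltnSn k)); rewrite eqxx/= in_itv.
  by move=> Xk j _; case: eqP => // ->; rewrite /= in_itv.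
move=> e; apply: (etrans (e _)); first by move=> j; case: eqP.
by rewrite big_ord_recr/= eqxx exponential_law_Nyc maxxx mulr0 oppr0 expR0 subrr mule0.
Qed.

Let tail n m (B : nat -> set R) : set T := [set w | forall j, (n <= j < m)%N -> B j (X j w)].

Let measurable_tail n m B : (forall j, measurable (B j)) -> measurable (tail n m B).
Proof.
move=> mB; rewrite (_ : tail n m B = \bigcap_(j in [set j | (n <= j < m)%N]) X j @^-1` B j).
  apply: bigcap_measurableType => j _; rewrite -[_ @^-1` _]setTI.
  exact: measurable_funP.
by apply/seteqP; split.
Qed.

Let slab n m B e s k :=
  [set w | S n w <= s] `&` tail n m (fun j => if j == n then cell e k else B j).

Let measurable_slab n m B e s k : (forall j, measurable (B j)) ->
  measurable (slab n m B e s k).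
Proof.
move=> mB; apply: measurableI.
  by rewrite -[X in measurable X]setTI; exact: measurable_fun_le.
by apply: measurable_tail => j; case: eqP => // _; rewrite /cell.
Qed.

Let slab_tail n m B e s k w : (n < m)%N -> slab n m B e s k w <->
  [/\ S n w <= s, cell e k (X n w) & tail n.+1 m B w].
Proof.
move=> nm; split=> [[Sw tw]|[Sw cw tw]]; split=> //.
- by have := tw n; rewrite leqnn nm eqxx; apply.
- move=> j /andP[nj jm]; have := tw j; rewrite (ltnW nj) jm (gtn_eqF nj); exact.
- move=> j /andP[nj jm]; case: eqVneq => [->//|jn]; apply: tw.
  by rewrite jm andbT ltn_neqAle eq_sym jn.
Qed.

(** Bounding [S n] by [t] minus the right end of the cell of [X n] forces the next sum below [t],
    and distinct cells give disjoint slabs. *)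
Let slab_lower n m B (t : R) M : (n < m)%N -> 0 < t -> (forall j, measurable (B j)) ->
  (\sum_(k < M.+1) P (slab n m B (t / M.+1%:R)%R (t - k.+1%:R * (t / M.+1%:R))%R k) <=
   P ([set w | (S n.+1 w <= t)%R] `&` tail n.+1 m B))%E.
Proof.
move=> nm t0 mB; have e0 : 0 < t / M.+1%:R by rewrite divr_gt0.
apply: le_sum_measure => [|||k _ w|k j _ _ [w []]].
- exact: index_enum_uniq.
- apply: measurableI; last exact: measurable_tail.
  by rewrite -[X in measurable X]setTI; exact: measurable_fun_le.
- by move=> k _; exact: measurable_slab.
- case/(slab_tail _ _ _ _ _ nm) => Sw; rewrite /cell/= in_itv/= => /andP[_ Xw] tw.
  by split=> //=; rewrite /S big_ord_recr/= -lerBrDr (le_trans Sw)// lerD2l lerN2.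
case/(slab_tail _ _ _ _ _ nm) => _ ck _; case/(slab_tail _ _ _ _ _ nm) => _ cj _.
apply/val_inj/(trivIset_cell e0 (i := val k) (j := val j)) => //.
by exists (X n w).
Qed.

(** With the left end of the cell instead, the slabs cover the event outside the null set where some
    variable is nonpositive. *)
Let slab_upper n m B (t : R) M : (n < m)%N -> 0 < t -> (forall j, measurable (B j)) ->
  (P ([set w | (S n.+1 w <= t)%R] `&` tail n.+1 m B) <=
   \sum_(k < M.+1) P (slab n m B (t / M.+1%:R)%R (t - k%:R * (t / M.+1%:R))%R k))%E.
Proof.
move=> nm t0 mB; set e := t / M.+1%:R; have e0 : 0 < e by rewrite divr_gt0.
have Me : M.+1%:R * e = t by rewrite mulrC divfK// pnatr_eq0.
have [N [mN PN subN]] := positive_X.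
pose U := \big[setU/set0]_(k < M.+1) slab n m B e (t - k%:R * e) k.
have mU : measurable U by apply: bigsetU_measurable => k _; exact: measurable_slab.
apply: (@le_trans _ _ (P (U `|` N))).
  apply: le_measure; rewrite ?inE.
  - apply: measurableI; last exact: measurable_tail.
    by rewrite -[X in measurable X]setTI; exact: measurable_fun_le.
  - exact: measurableU.
  move=> w [/= Sw tw]; have [Nw|Nw] := pselect (N w); first by right.
  left; have X0 j : 0 < X j w.
    by rewrite ltNge; apply/negP => Xj; apply: Nw; apply: subN; exists j.
  have S0 : 0 <= S n w by apply: sumr_ge0 => j _; exact/ltW.
  move: Sw; rewrite /S big_ord_recr/= -/(S n w) => Sw.
  have Xt : X n w <= M.+1%:R * e by rewrite Me (le_trans _ Sw)// lerDr.
  have [k [kM Xk]] : exists k, (k < M.+1)%N /\ cell e k (X n w).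
    have ex : exists j, X n w <= j%:R * e by exists M.+1.
    case: (ex_minnP ex) => -[|k] Xk kmin.
      by move: Xk; rewrite mulr0n mul0r leNgt X0.
    exists k; split; first exact: kmin.
    rewrite /cell/= in_itv/= Xk andbT ltNge; apply/negP => /kmin.
    by rewrite ltnn.
  rewrite /U -(bigcup_mkord M.+1 (fun k => slab n m B e (t - k%:R * e) k)).
  exists k => //=; apply/(slab_tail _ _ _ _ _ nm); split=> //.
  move: Xk; rewrite /cell/= in_itv/= => /andP[Xk _].
  by rewrite lerBrDr (le_trans _ Sw)// lerD2l ltW.
have leU : (P (U `|` N) <= P U + P N)%E by exact: measureU2.
have P0 : P N = 0%E by exact: PN.
rewrite P0 adde0 in leU; apply: le_trans leU _.
apply: (@Boole_inequality _ _ _ P (fun k => slab n m B e (t - k%:R * e) k)) => k _.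
exact: measurable_slab.
Qed.

(** Carrying constraints on the later variables is what makes the induction work: the hypothesis at
    [n], with a cell as constraint on [X n], already contains the independence of [S n] from [X n]
    and its successors. *)
Lemma sum_cdf_tail n m t (B : nat -> set R) : (n <= m)%N -> 0 <= t ->
  (forall j, measurable (B j)) ->
  P ([set w | S n w <= t] `&` tail n m B) =
  (((1 - expR (- t)) ^+ n)%:E * \prod_(n <= j < m) yule_law j (B j))%E.
Proof.
elim: n m t B => [|n IH] m t B nm t0 mB.
  rewrite expr0 mul1e big_mkord -boxX//; congr (P _); apply/seteqP; split=> w.
    by case=> _ tw k km; exact: tw.
  by move=> H; split=> /=; [rewrite /S big_ord0|move=> k /andP[_]; exact: H].
have cE : (\prod_(n.+1 <= j < m) yule_law j (B j))%E \is a fin_num.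
  by apply: prode_fin_num => j _; exact: fin_num_measure.
have c0 : (0 <= \prod_(n.+1 <= j < m) yule_law j (B j))%E.
  by apply: prode_ge0 => j _; exact: measure_ge0.
have [c cdef] : exists c : R, (\prod_(n.+1 <= j < m) yule_law j (B j))%E = c%:E.
  by exists (fine (\prod_(n.+1 <= j < m) yule_law j (B j))%E); rewrite fineK.
rewrite cdef lee_fin in c0.
have slabE e s k : 0 < e -> 0 <= s -> P (slab n m B e s k) =
    ((1 - expR (- s)) ^+ n *
     (expR (- (n.+1%:R * (k%:R * e))) - expR (- (n.+1%:R * (k.+1%:R * e)))) * c)%:E.
  move=> e0 s0; rewrite /slab IH//; last 2 first.
  - exact: ltnW.
  - by move=> j; case: eqP => // _; rewrite /cell.
  rewrite big_ltn// eqxx (eq_big_nat _ _ (F2 := fun j => yule_law j (B j))).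
    have -> : yule_law n (cell e k) = (expR (- (n.+1%:R * (k%:R * e)))
        - expR (- (n.+1%:R * (k.+1%:R * e))))%:E by exact: exponential_law_cell.
    by rewrite cdef -!EFinM; congr EFin; ring.
  by move=> j /andP[nj _]; rewrite gtn_eqF.
have mW : measurable ([set w | S n.+1 w <= t] `&` tail n.+1 m B).
  apply: measurableI; last exact: measurable_tail.
  by rewrite -[X in measurable X]setTI; exact: measurable_fun_le.
rewrite cdef -EFinM.
(* At t = 0 the mesh would vanish; there the event is null since the first variable is almost surely
   positive. *)
move: t0; rewrite le_eqVlt => /predU1P[<-|t0].
  rewrite oppr0 expR0 subrr exprS !mul0r.
  have [N [mN PN subN]] := positive_X.
  apply: (@subset_measure0 _ _ _ P _ N) => //.
    apply: measurableI; last exact: measurable_tail.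
    by rewrite -[X in measurable X]setTI; exact: measurable_fun_le.
  move=> w [/= Sw _]; apply: contrapT => Nw.
  have X0 j : 0 < X j w.
    by rewrite ltNge; apply/negP => Xj; apply: Nw; apply: subN; exists j.
  move: Sw; rewrite leNgt => /negP; apply; rewrite /S big_ord_recl/=.
  by rewrite ltr_pwDl// sumr_ge0// => j _; exact: ltW.
have bounds M : c * \sum_(k < M.+1) (1 - expR (- (t - k.+1%:R * (t / M.+1%:R)))) ^+ n *
     (expR (- (n.+1%:R * (k%:R * (t / M.+1%:R))))
      - expR (- (n.+1%:R * (k.+1%:R * (t / M.+1%:R)))))
   <= fine (P ([set w | S n.+1 w <= t] `&` tail n.+1 m B)) <=
   c * \sum_(k < M.+1) (1 - expR (- (t - k%:R * (t / M.+1%:R)))) ^+ n *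
     (expR (- (n.+1%:R * (k%:R * (t / M.+1%:R))))
      - expR (- (n.+1%:R * (k.+1%:R * (t / M.+1%:R))))).
  have e0 : 0 < t / M.+1%:R by rewrite divr_gt0.
  have te k : (k <= M.+1)%N -> 0 <= t - k%:R * (t / M.+1%:R).
    move=> kM; rewrite subr_ge0 mulrCA; apply: ler_piMr; first exact: ltW.
    by rewrite ler_pdivrMr// mul1r ler_nat.
  rewrite -!lee_fin fineK ?fin_num_measure// !(mulrC c) !mulr_suml -!sumEFin.
  apply/andP; split.
    rewrite (eq_bigr _ (fun (k : 'I_M.+1) _ => esym (slabE _ _ k e0 (te k.+1 (ltn_ord k))))).
    exact: slab_lower.
  rewrite (eq_bigr _ (fun (k : 'I_M.+1) _ => esym (slabE _ _ k e0 (te k (ltnW (ltn_ord k)))))).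
  exact: slab_upper.
rewrite -[LHS]fineK ?fin_num_measure//; congr EFin.
move: (fine _) bounds => x bounds.
pose K := c * (n.+1%:R * t).
(* Both numbers lie between the same lower and upper sums, whose difference is at most
   [K / M.+1%:R]. As [M] is arbitrary, they coincide by the Archimedean property. *)
have close M : M.+1%:R * `|x - (1 - expR (- t)) ^+ n.+1 * c| <= K.
  have /andP[b1 b2] := bounds M.
  have /andP[r1 r2] := riemann_sandwich n M t0.
  have := riemann_gap n M t0; set A := \sum_(k < _) _ in b2 r2 *.
  set A' := \sum_(k < _) _ in b1 r1 *.
  move: (_ ^+ n.+1) A A' r1 r2 b1 b2 => G A A' r1 r2 b1 b2 gap.
  have cA : c * A - c * A' <= c * (n.+1%:R * (t / M.+1%:R)) by rewrite -mulrBr ler_wpM2l.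
  have cA1 : c * A' <= G * c by rewrite mulrC ler_wpM2r.
  have cA2 : G * c <= c * A by rewrite mulrC ler_wpM2l.
  have KE : c * (n.+1%:R * (t / M.+1%:R)) = K / M.+1%:R by rewrite /K; ring.
  rewrite mulrC -ler_pdivlMr// ler_norml -KE.
  by rewrite lerNl opprB; apply/andP; split; apply: le_trans cA; apply: lerB.
apply/eqP; rewrite -subr_eq0 -normr_eq0; apply/negPn/negP => nz.
have d0 : 0 < `|x - (1 - expR (- t)) ^+ n.+1 * c| by rewrite lt_def nz normr_ge0.
have := close (Num.truncn (K / `|x - (1 - expR (- t)) ^+ n.+1 * c|)).
by rewrite -ler_pdivlMr// leNgt truncnS_gt.
Qed.

Lemma sum_of_exponentials_cdf n t : 0 <= t ->
  P [set w | \sum_(k < n) X k w <= t] = ((1 - expR (- t)) ^+ n)%:E.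
Proof.
move=> t0; have := @sum_cdf_tail n n t (fun=> setT) (leqnn n) t0 (fun=> measurableT).
rewrite big_geq// mule1 => <-; congr (P _); rewrite (_ : tail _ _ _ = setT) ?setIT//.
by apply/seteqP; split.
Qed.

End sum_of_exponentials.

(** * The limit *)

(** Fatou's lemma for events: up to a null set [A] is the increasing union of the sets [F J], and
    each of these lies in all [B j] with [j] at least [J]. *)
Lemma probability_le_of_eventually d (T : measurableType d) (R : realType)
    (P : probability T R) (A : set T) (B : nat -> set T) (c : nat -> R) (l : R) :
  measurable A -> (forall j, measurable (B j)) ->
  {ae P, forall w, A w -> \forall j \near \oo, B j w} ->
  (forall j, (P (B j) <= (c j)%:E)%E) -> c @ \oo --> l -> (P A <= l%:E)%E.
Proof.
move=> mA mB [N [mN PN subN]] Bc cl.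
pose F J := A `&` \bigcap_(j in [set j | (J <= j)%N]) B j.
have mF J : measurable (F J).
  by apply: measurableI => //; apply: bigcap_measurableType => j _.
have Fnd : nondecreasing_seq F.
  move=> I J IJ; apply/subsetPset; apply: setIS => w H j /= Jj.
  by apply: H => /=; exact: leq_trans Jj.
have mU : measurable (\bigcup_J F J) by exact: bigcup_measurable.
have cvgF := @nondecreasing_cvg_mu _ _ _ P F mF mU Fnd.
have PAU : (P A <= P (\bigcup_J F J))%E.
  have leU : (P (\bigcup_J F J `|` N) <= P (\bigcup_J F J) + P N)%E by exact: measureU2.
  have P0 : P N = 0%E by exact: PN.
  rewrite P0 adde0 in leU; apply: le_trans leU; apply: le_measure; rewrite ?inE//.
    exact: measurableU.
  move=> w Aw; have [Nw|Nw] := pselect (N w); [by right|left].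
  have [J _ HJ] : \forall j \near \oo, B j w.
    by apply: contrapT => nB; apply: Nw; apply: subN => /= H; exact: nB (H Aw).
  by exists J => //; split.
apply: le_trans PAU _.
have cl' : (fun j => (c j)%:E) @ \oo --> l%:E by apply: cvg_EFin => //; near=> j.
rewrite -(cvg_lim _ cvgF)// -(cvg_lim _ cl')//; apply: lee_lim.
- by apply/cvg_ex; exists (P (\bigcup_J F J)).
- by apply/cvg_ex; exists l%:E.
near=> j; apply: le_trans (Bc j); apply: le_measure; rewrite ?inE//.
by move=> w [_ /(_ j)]; apply; rewrite /=.
Unshelve. all: by end_near. Qed.

Section geometric_limit.
Context {R : realType}.
Variable x : R.
Hypothesis x0 : 0 <= x.

Let N (j : nat) : nat := Num.truncn (x * expR j%:R).

Let cvg_expRNn : (fun j => expR (- j%:R)) @ \oo --> (0 : R).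
Proof.
have := @cvg_expRN_shift R 0 0.
by under eq_fun do rewrite mul1r mulr0 subr0 addn0.
Qed.

Let u01 (j : nat) : 0 < expR (- j%:R : R) <= 1.
Proof. by rewrite expR_gt0 -[leRHS]expR0 ler_expR oppr_le0/=. Qed.

Let N_bounds (j : nat) : x - expR (- j%:R) <= (N j)%:R * expR (- j%:R) <= x.
Proof.
have /andP[n1 n2] := truncn_itv (mulr_ge0 x0 (expR_ge0 (j%:R : R))).
rewrite expRN ler_pdivrMr ?expR_gt0// n1 andbT.
rewrite ler_pdivlMr ?expR_gt0// mulrBl mulVf ?gt_eqF ?expR_gt0//.
by rewrite lerBlDr natr1 ltW.
Qed.

(** Uses 1 - u <= exp(- u) with u = exp(- j), and N u > x - u for the truncated value N of x / u. *)
Lemma geometric_tail_le j :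
  (1 - expR (- j%:R)) ^+ N j <= expR (- (x - expR (- j%:R))).
Proof.
have /andP[u0 u1] := u01 j; have /andP[n1 n2] := N_bounds j.
apply: (@le_trans _ _ (expR (- expR (- j%:R)) ^+ N j)).
  apply: lerXn2r; rewrite ?nnegrE ?subr_ge0 ?expR_ge0//.
  exact: expR_ge1Dx.
by rewrite -expRM_natl ler_expR mulrN lerN2.
Qed.

(** Uses exp(u / (1 - u)) >= 1 + u / (1 - u) = 1 / (1 - u), together with N u <= x. A positive [j]
    keeps u below 1. *)
Lemma geometric_tail_ge j : (0 < j)%N ->
  expR (- (x / (1 - expR (- j%:R)))) <= (1 - expR (- j%:R)) ^+ N j.
Proof.
move=> j0; have /andP[u0 u1] := u01 j; have /andP[n1 n2] := N_bounds j.
have v0 : 0 < 1 - expR (- j%:R) :> R.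
  by rewrite subr_gt0 -[ltRHS]expR0 ltr_expR oppr_lt0 ltr0n.
set u := expR (- j%:R) in u0 u1 n1 n2 v0 *.
apply: (@le_trans _ _ (expR (- (u / (1 - u))) ^+ N j)).
  rewrite -expRM_natl ler_expR mulrN lerN2 mulrA ler_pM2r ?invr_gt0//.
apply: lerXn2r; rewrite ?nnegrE ?expR_ge0 ?(ltW v0)//.
rewrite expRN -[leRHS]invrK lef_pV2 ?posrE ?invr_gt0 ?expR_gt0//.
apply: le_trans (expR_ge1Dx _); rewrite le_eqVlt; apply/orP; left; apply/eqP.
by field; rewrite gt_eqF.
Qed.

Lemma cvg_geometric_tail_le :
  (fun j => expR (- (x - expR (- j%:R)))) @ \oo --> expR (- x).
Proof.
apply: continuous_cvg; first exact: continuous_expR.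
apply: cvgN; rewrite -[X in _ --> X]subr0; apply: cvgB => //; exact: cvg_cst.
Qed.

Lemma cvg_geometric_tail_ge :
  (fun j => expR (- (x / (1 - expR (- j%:R))))) @ \oo --> expR (- x).
Proof.
apply: continuous_cvg; first exact: continuous_expR.
apply: cvgN; have xE : x * (1 - 0)^-1 = x by rewrite subr0 invr1 mulr1.
rewrite -[X in _ --> X]xE; apply: cvgM; first exact: cvg_cst.
apply: cvgV; first by rewrite subr0 oner_neq0.
by apply: cvgB => //; exact: cvg_cst.
Qed.

End geometric_limit.

Section limit_law.
Context {R : realType} {dT} {T : measurableType dT} (P : probability T R).
Variable xi : label -> nat -> {RV P >-> R}.
Hypothesis hxi : cmj_process 1 xi.

Let ages u k : T -> R := xi u k.

(** A population above [y] has at least [(Num.truncn y).+1] members. One of them is the root, so the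
    condition is that [Num.truncn y] further births have taken place. *)
Lemma cmj_size_gt w t y : (forall u k, 0 < xi u k w) ->
  (forall n, exists2 h, h \in histories n & first_births ages h w) ->
  0 <= t -> 0 <= y ->
  (y%:E < cmj_size ages t w)%E = (\sum_(k < Num.truncn y) interbirth xi k w <= t).
Proof.
move=> xi0 hist t0 y0; rewrite cmj_sizeE//.
set D := [set n | _].
have Ddown j k : (j <= k)%N -> D k -> D j.
  rewrite /D/= !sum_interbirth// => jk; apply: le_trans.
  exact: nth_birth_le.
have DE : (\sum_(k < Num.truncn y) interbirth xi k w <= t) =
    (Num.truncn y == 0%N) || `[< D (Num.truncn y).-1 >].
  case: (Num.truncn y) => [|m] /=; first by rewrite big_ord0.
  by apply/idP/asboolP.
rewrite DE; have [fD|iD] := pselect (finite_set D); last first.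
  rewrite counting_infinite// addey// ltry.
  by rewrite (infinite_downclosed iD Ddown) asboolT// orbT.
have [N DN] := finite_downclosed fD Ddown.
rewrite DN (counting_card_eq (card_eqxx _)) -EFinD lte_fin addrC natr1.
rewrite -truncn_lt_nat//; case: (Num.truncn y) => [|m] //=.
by apply/idP/asboolP => /=; rewrite ltnS.
Qed.

Variable M : {RV P >-> R}.
Hypothesis hM : cmj_limit ages M.

Let B (x : R) (j : nat) :=
  [set w | \sum_(k < Num.truncn (x * expR j%:R)) interbirth xi k w <= j%:R].

Let measurable_B x j : measurable (B x j).
Proof.
rewrite -[X in measurable X]setTI; apply: measurable_fun_le => //.
by apply: measurable_sum => k; exact: measurable_interbirth.
Qed.

Let P_B (x : R) (j : nat) : P (B x j) = ((1 - expR (- j%:R)) ^+ Num.truncn (x * expR j%:R))%:E.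
Proof.
exact: (@sum_of_exponentials_cdf _ _ _ P (fun n => interbirth xi n : {RV P >-> R})
  (interbirth_boxE hxi)).
Qed.

Let B_ae : {ae P, forall w,
  ((expR (- j%:R))%:E * cmj_size ages j%:R w)%E @[j --> \oo] --> (M w)%:E /\
  forall x j, 0 <= x -> B x j w <-> (x%:E < (expR (- j%:R))%:E * cmj_size ages j%:R w)%E}.
Proof.
have := histories_ae hxi; have := hM; apply: filterS2 => w Mw [xi0 hist]; split.
  apply: (cvg_comp (fun j : nat => (j%:R : R)) _ _ Mw); exact: cvgr_idn.
move=> x j x0; rewrite /B/= -cmj_size_gt ?mulr_ge0 ?expR_ge0//.
by rewrite expRN lte_pdivlMl ?expR_gt0// -EFinM mulrC.
Qed.

Let measurable_gt (x : R) : measurable [set w | x < M w].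
Proof.
rewrite (_ : [set w | _] = ~` [set w | M w <= x]).
  by apply: measurableC; rewrite -[X in measurable X]setTI; exact: measurable_fun_le.
by apply/seteqP; split=> w /=; rewrite ltNge => /negP.
Qed.

Let measurable_lt (x : R) : measurable [set w | M w < x].
Proof.
rewrite (_ : [set w | _] = ~` [set w | x <= M w]).
  by apply: measurableC; rewrite -[X in measurable X]setTI; exact: measurable_fun_le.
by apply/seteqP; split=> w /=; rewrite ltNge => /negP.
Qed.

Lemma cmj_limit_gt_le x : 0 <= x -> (P [set w | (x < M w)%R] <= (expR (- x))%:E)%E.
Proof.
move=> x0; apply: (@probability_le_of_eventually _ _ _ P _ (B x)
  (fun j => expR (- (x - expR (- j%:R))))) => //.
- have := B_ae; apply: filterS => w [Mw HB] xM.
  have : \forall j \near \oo, (x%:E < (expR (- j%:R))%:E * cmj_size ages j%:R w)%E.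
    apply: (Mw [set y | (x%:E < y)%E]); apply: open_nbhs_nbhs.
    by split; [exact: open_ereal_gt_ereal|rewrite /= lte_fin].
  by apply: filterS => j Hj; apply/(HB x j x0).
- by move=> j; rewrite P_B lee_fin geometric_tail_le.
- exact: cvg_geometric_tail_le.
Qed.

Lemma cmj_limit_lt_le x : 0 <= x -> (P [set w | (M w < x)%R] <= (1 - expR (- x))%:E)%E.
Proof.
(* The index is shifted because [geometric_tail_ge] requires a positive time. *)
move=> x0; apply: (@probability_le_of_eventually _ _ _ P _ (fun j => ~` B x j.+1)
  (fun j => 1 - expR (- (x / (1 - expR (- j.+1%:R)))))) => //.
- by move=> j; exact: measurableC.
- have := B_ae; apply: filterS => w [Mw HB] Mx.
  have [J _ HJ] : \forall j \near \oo, ((expR (- j%:R))%:E * cmj_size ages j%:R w < x%:E)%E.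
    apply: (Mw [set y | (y < x%:E)%E]); apply: open_nbhs_nbhs.
    by split; [exact: open_ereal_lt_ereal|rewrite /= lte_fin].
  exists J => // j /= Jj /(HB x j.+1 x0); apply/negP; rewrite -leNgt; apply/ltW.
  by apply: HJ => /=; exact: leqW.
- by move=> j; rewrite probability_setC// P_B -EFinB lee_fin lerD2l lerN2 geometric_tail_ge.
- apply: cvgB; first exact: cvg_cst.
  have := @cvg_geometric_tail_ge R x.
  by rewrite -(cvg_shiftS (fun j => expR (- (x / (1 - expR (- j%:R)))))).
Qed.

(** An atom could separate {M > x} from {M >= x}, so the lower bound on the former goes through {M
    >= y} for y > x, and y then decreases to x along [x + harmonic j]. *)
Lemma cmj_limit_law A : measurable A -> distribution P M A = exponential_prob 1 A.
Proof.
move=> mA; transitivity (exponential_law (@ltr01 R) A) => //.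
apply: measure_rays_unique => // [|x].
  rewrite [X in (X < _)%E](_ : _ = 1%E) ?ltry//; last first.
  exact: (@probability_setT _ _ _ (distribution P M)).
transitivity ((expR (- Num.max 0 x))%:E); last first.
  by have := exponential_law_oy (@ltr01 R) x; rewrite mul1r => <-.
transitivity (P [set w | x < M w]).
  rewrite /distribution/= /pushforward; congr (P _).
  by apply/seteqP; split=> w /=; rewrite in_itv/= andbT.
have ge_max y : x < y -> ((expR (- Num.max 0 y)%R)%:E <= P [set w | (x < M w)%R])%E.
  move=> xy; have m0 : 0 <= Num.max 0 y by rewrite le_max lexx.
  have : (P [set w | (Num.max 0 y <= M w)%R] <= P [set w | (x < M w)%R])%E.
    apply: le_measure; rewrite ?inE//.
      by rewrite -[X in measurable X]setTI; exact: measurable_fun_le.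
    move=> w /= my; apply: lt_le_trans xy _; apply: le_trans my.
    by rewrite le_max lexx orbT.
  apply: le_trans.
  rewrite (_ : [set w | _] = ~` [set w | M w < Num.max 0 y]); last first.
    by apply/seteqP; split=> w /=; rewrite leNgt => /negP.
  rewrite probability_setC// -[X in (X <= _)%E](_ : 1 - (1 - expR (- Num.max 0 y)%R)%:E = _)%E.
    by apply: leeB => //; exact: cmj_limit_lt_le.
  by rewrite -EFinB; congr EFin; ring.
have Pfin := fin_num_measure P _ (measurable_gt x).
apply/eqP; rewrite eq_le; apply/andP; split.
  have [x0|x0] := leP 0 x; first exact: cmj_limit_gt_le.
  by rewrite oppr0 expR0 probability_le1.
have [x0|x0] := leP 0 x; last by have := ge_max 0 x0; rewrite maxxx.
rewrite -(fineK Pfin) lee_fin.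
have lim : (fun j => expR (- (x + harmonic j))) @ \oo --> expR (- x).
  by have := @cvg_expRN_affine R 1 x 1; under eq_fun do rewrite mul1r mulr1; rewrite mul1r.
apply: (cvgr_to_le lim); near=> j; rewrite -lee_fin fineK//.
have h0 : 0 < harmonic j :> R by rewrite invr_gt0.
have := ge_max (x + harmonic j); rewrite max_r ?addr_ge0 ?(ltW h0)//; apply.
by rewrite ltrDl.
Unshelve. all: by end_near. Qed.

End limit_law.

(** * Gumbel variables *)

Section gumbel.
Context {R : realType}.

Lemma measurable_neg_ln_id : measurable_fun setT (fun m : R => - ln m).
Proof. by apply: measurableT_comp. Qed.

Lemma neg_ln_gumbel d (T : measurableType d) (P : probability T R) (M : {RV P >-> R}) :
  same_law (distribution P M) (exponential_prob 1) ->
  standard_gumbel (neg_ln M : {RV P >-> R}).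
Proof.
move=> lawM x; set a := expR (- x); have a0 : 0 < a by exact: expR_gt0.
pose A := [set m : R | - ln m <= x].
have mA : measurable A.
  rewrite -[X in measurable X]setTI; apply: measurable_fun_le => //.
  exact: measurable_neg_ln_id.
transitivity (exponential_law (@ltr01 R) A).
  rewrite -[RHS](lawM A mA) /cdf/= /distribution/= /pushforward.
  by congr (P _); apply/seteqP; split=> w /=; rewrite in_itv.
have lawoy : exponential_law (@ltr01 R) `]a, +oo[%classic = (expR (- a))%:E.
  by have := exponential_law_oy (@ltr01 R) a; rewrite mul1r max_r// ltW.
apply/eqP; rewrite eq_le -lawoy; apply/andP; split; last first.
  apply: le_measure; rewrite ?inE// => m /=; rewrite in_itv/= andbT => am.
  by rewrite /A/= lerNl -[leLHS]expRK ler_ln ?posrE ?(lt_trans a0 am)// ltW.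
(* The event is the ray beyond [a] up to the point [a] and nonpositive numbers, where [ln] only has
   a default value; the exponential law charges neither. *)
have law0 : exponential_law (@ltr01 R) (`]-oo, 0%R]%classic `|` [set a]) = 0%E.
  apply/eqP; rewrite eq_le measure_ge0 andbT.
  have leU : (exponential_law (@ltr01 R) (`]-oo, 0%R]%classic `|` [set a]) <=
      exponential_law (@ltr01 R) `]-oo, 0%R]%classic + exponential_law (@ltr01 R) [set a])%E.
    by apply: measureU2.
  apply: le_trans leU _; rewrite exponential_law_Nyc maxxx mulr0 oppr0 expR0 subrr add0e.
  by rewrite /exponential_law /exponential_prob integral_set1.
have leU : (exponential_law (@ltr01 R)
      ((`]-oo, 0%R]%classic `|` [set a]) `|` `]a, +oo[%classic) <=
    exponential_law (@ltr01 R) (`]-oo, 0%R]%classic `|` [set a]) +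
    exponential_law (@ltr01 R) `]a, +oo[%classic)%E.
  by apply: measureU2 => //; exact: measurableU.
rewrite law0 add0e in leU; apply: le_trans leU; apply: le_measure; rewrite ?inE//.
  by apply: measurableU => //; exact: measurableU.
move=> m; rewrite /A/= !in_itv/= andbT => mx.
have [m0|m0] := leP m 0; first by left; left.
have : a <= m by rewrite -[leRHS]lnK ?posrE// ler_expR lerNl.
by rewrite le_eqVlt => /predU1P[<-|]; [left; right|right].
Qed.

(** Giving the full event to indices outside [J] reduces every [J] to all three. The independence of
    the pair from [G3] is then applied to a rectangle of preimages under - ln. *)
Lemma independent_neg_ln3 d (T : measurableType d) (P : probability T R)
    (M1 M2 G3 : {RV P >-> R}) :
  independent2 P M1 M2 -> independent2 P (fun w => (M1 w, M2 w)) G3 ->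
  mutually_independent P
    (tnth [tuple (neg_ln M1 : T -> R); (neg_ln M2 : T -> R); (G3 : T -> R)]).
Proof.
move=> ind12 ind3 J A mA.
pose X := tnth [tuple (neg_ln M1 : T -> R); (neg_ln M2 : T -> R); (G3 : T -> R)].
have {mA} [B mB BA] : exists2 B : 'I_3 -> set R,
    (forall k, measurable (B k)) &
    forall k, if k \in J then A k = X k @^-1` B k else B k = setT.
  have B_ k : {B : set R | measurable B & if k \in J then A k = X k @^-1` B else B = setT}.
    have [/mA kJ|kJ] := boolP (k \in J); last by exists setT.
    by have [B mB <-] := cid2 kJ; exists B => //; rewrite setTI.
  by exists (fun k => s2val (B_ k)) => k; [exact: (s2valP (B_ k))|exact: (s2valP' (B_ k))].
pose C k := X k @^-1` B k.
pose i0 := @Ordinal 3 0 isT; pose i1 := @Ordinal 3 1 isT; pose i2 := @Ordinal 3 2 isT.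
have ord3 (Q : 'I_3 -> Prop) : Q i0 -> Q i1 -> Q i2 -> forall i, Q i.
  move=> Q0 Q1 Q2 [[|[|[|//]]] lt_i].
  - by rewrite (_ : Ordinal lt_i = i0)//; exact: val_inj.
  - by rewrite (_ : Ordinal lt_i = i1)//; exact: val_inj.
  - by rewrite (_ : Ordinal lt_i = i2)//; exact: val_inj.
have -> : \bigcap_(i in [set` J]) A i = (C i0 `&` C i1) `&` C i2.
  apply/seteqP; split=> w /=.
    move=> H; have HC k : C k w.
      have := BA k; rewrite /C; case: ifP => [kJ <-|_ ->//]; exact: H.
    by [].
  move=> [[C0 C1] C2] i iJ; have := BA i; rewrite iJ => ->.
  by move: i {iJ}; exact: ord3.
have PA k : k \in J -> P (A k) = P (C k) by move=> kJ; have := BA k; rewrite kJ => ->.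
have -> : (\prod_(i <- J) P (A i) = \prod_(i < 3) P (C i))%E.
  rewrite big_seq (eq_bigr _ PA) -big_seq big_uniq ?fset_uniq//= big_mkcond/=.
  apply: eq_bigr => i _; case: ifPn => // /negPf iJ.
  by have := BA i; rewrite iJ /C => ->; rewrite preimage_setT probability_setT.
have mD k : measurable ((fun m : R => - ln m) @^-1` B k).
  by rewrite -[X in measurable X]setTI; exact: measurable_neg_ln_id.
transitivity (P (C i0 `&` C i1) * P (C i2))%E.
  exact: (ind3 ((fun m : R => - ln m) @^-1` B i0 `*` (fun m : R => - ln m) @^-1` B i1) (B i2)
    (measurableX (mD i0) (mD i1)) (mB i2)).
transitivity (P (C i0) * P (C i1) * P (C i2))%E.
  congr (_ * _)%E; exact: (ind12 _ _ (mD i0) (mD i1)).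
by rewrite !big_ord_recr big_ord0/= mul1e; congr (P (C _) * P (C _) * P (C _))%E; exact: val_inj.
Qed.

End gumbel.

Theorem corollary1p6 (R : realType)
    (d : measure_display) (T : measurableType d) (P : probability T R)
    (xi : seq nat -> nat -> {RV P >-> R}) (hxi : cmj_process 1 xi) :
  yule_process P 1 (cmj_size xi) /\
  forall M : {RV P >-> R}, cmj_limit xi M ->
    same_law (distribution P M) (exponential_prob 1) /\
    forall (d' : measure_display) (T' : measurableType d')
      (P' : probability T' R) (M1 M2 G3 : {RV P' >-> R})
      (d'' : measure_display) (T'' : measurableType d'')
      (P'' : probability T'' R) (S : {RV P'' >-> R}),
      is_S_infty 1 M M1 M2 G3 S ->
      let G1 : {RV P' >-> R} := neg_ln M1 in
      let G2 : {RV P' >-> R} := neg_ln M2 in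
      [/\ [/\ standard_gumbel G1, standard_gumbel G2 & standard_gumbel G3],
          mutually_independent P'
            (tnth [tuple (G1 : T' -> R); (G2 : T' -> R); (G3 : T' -> R)])
        & same_law (distribution P'' S)
            (distribution P' (G1 + G2 - G3 : {mfun T' >-> R}))].
Proof.
split; first exact: cmj_size_yule.
move=> M hM; have lawM : same_law (distribution P M) (exponential_prob 1).
  by move=> A; exact: (cmj_limit_law hxi hM).
split=> // d' T' P' M1 M2 G3 d'' T'' P'' S [[law1 law2] ind12 gum3 ind3 lawS] G1 G2.
split.
- split=> //; apply: neg_ln_gumbel => A mA.
    by rewrite law1// lawM.
  by rewrite law2// lawM.
- exact: independent_neg_ln3.
move=> A mA; rewrite lawS//; congr (distribution P' _ A).
apply/mfuneqP => w /=; by rewrite ln1 subr0.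
Qed.
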